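(* Let $X$ be a homotopically trivial non-contractible topological space. Then $X$ has at least nine points, i.e. $\# X\geq 9$.
   Context: $\#X$ denotes the cardinality of the underlying set of $X$. A topological space is homotopically trivial (weakly contractible) if it is non-empty, path-connected and all its homotopy groups are trivial, i.e. the map from it to a point is a weak homotopy equivalence. Contractible means homotopy equivalent to a point. No finiteness or separation assumption is made on $X$. *)

(* Defs.v *)
From HB Require Import structures.
From mathcomp Require Import all_boot all_order all_algebra.
From mathcomp Require Import all_classical all_reals all_analysis.
From mathcomp Require Import homotopy.

Set Implicit Arguments.
Unset Strict Implicit.
Unset Printing Implicit Defensive.

Import Order.TTheory GRing.Theory Num.Theory.
Import numFieldNormedType.Exports.

Local Open Scope classical_set_scope.
Local Open Scope ring_scope.

(* Subsets are used as types through [set_type], which carries the subspace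
   topology; 'rV[R]_n carries the product topology. *)
Definition unit_interval (R : realType) : Type :=
  set_type (`[0, 1]%classic : set R).

HB.instance Definition _ (R : realType) :=
  Topological.copy (unit_interval R) (set_type (`[0, 1]%classic : set R)).

Section UnitInterval.
Variable R : realType.

Fact unit_interval0_subproof : (0 : R) \in `[0, 1]%classic.
Proof. by rewrite inE /= in_itv /= lexx ler01. Qed.

Fact unit_interval1_subproof : (1 : R) \in `[0, 1]%classic.
Proof. by rewrite inE /= in_itv /= lexx ler01. Qed.

Definition I0 : unit_interval R := SigSub unit_interval0_subproof.
Definition I1 : unit_interval R := SigSub unit_interval1_subproof.

Fact I0_neq_I1 : I0 != I1.
Proof. by apply/eqP => /(congr1 val) /= /esym/eqP; rewrite oner_eq0. Qed.

HB.instance Definition _ := isBiPointed.Build (unit_interval R) I0_neq_I1.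

End UnitInterval.

Definition cube (R : realType) (n : nat) : set 'rV[R]_n :=
  [set v | forall i, 0 <= v ord0 i <= 1].
Arguments cube : clear implicits.

Definition cube_boundary (R : realType) (n : nat) : set (set_type (cube R n)) :=
  [set s | exists i, (set_val s : 'rV[R]_n) ord0 i = 0 \/
                     (set_val s : 'rV[R]_n) ord0 i = 1].

Definition homotopic_rel (R : realType) (S X : topologicalType) (A : set S)
    (f g : S -> X) : Prop :=
  exists H : S * unit_interval R -> X,
    [/\ continuous H,
        forall s, H (s, zero) = f s,
        forall s, H (s, one) = g s &
        forall s t, A s -> H (s, t) = f s].

Definition homotopic (R : realType) (S X : topologicalType) (f g : S -> X) :=
  homotopic_rel R set0 f g.

Definition homotopy_equivalent (R : realType) (X Y : topologicalType) : Prop :=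
  exists (f : X -> Y) (g : Y -> X),
    [/\ continuous f, continuous g,
        homotopic R (g \o f) id & homotopic R (f \o g) id].

Definition contractible (R : realType) (X : topologicalType) : Prop :=
  homotopy_equivalent R X (discrete_topology unit).

Definition path_connected (R : realType) (X : topologicalType) : Prop :=
  forall x y : X, inhabited {path (unit_interval R) from x to y}.

(* Maps of pairs (I^n, boundary of I^n) -> (X, x). *)
Definition spheroid (R : realType) (X : topologicalType) (n : nat) (x : X) :
    set (set_type (cube R n) -> X) :=
  [set f | continuous f /\ forall s, cube_boundary s -> f s = x].

Definition spheroid_class (R : realType) (X : topologicalType) (n : nat)
    (x : X) (f : set_type (cube R n) -> X) : set (set_type (cube R n) -> X) :=
  [set g | spheroid x g /\ homotopic_rel R (@cube_boundary R n) f g].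

(* The underlying set of the n-th homotopy group at x; the group law is not
   needed since a group is trivial iff its underlying set is the singleton of
   its identity element, here the class of the constant map. *)
Definition homotopy_group (R : realType) (X : topologicalType) (n : nat)
    (x : X) : set (set (set_type (cube R n) -> X)) :=
  [set spheroid_class x f | f in spheroid x].
Arguments homotopy_group R {X} n x.

Definition trivial_homotopy_group (R : realType) (X : topologicalType)
    (n : nat) (x : X) : Prop :=
  homotopy_group R n x = [set spheroid_class x (cst x)].

Definition homotopically_trivial (R : realType) (X : topologicalType) : Prop :=
  [/\ [set: X] !=set0, path_connected R X &
      forall (n : nat) (x : X), (0 < n)%N -> trivial_homotopy_group R n x].

(* Main.v *)
Require Import Defs.
From mathcomp Require Import all_boot all_order all_algebra.
From mathcomp Require Import all_classical all_reals all_analysis.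
From mathcomp Require Import homotopy zify.

(* A finite space is a finite preorder, and collapsing beat points replaces it,
   up to homotopy, by a core: a poset in which no point has a unique upper or
   lower cover.  It is thus enough to see that a core with 2 to 8 points is
   never homotopically trivial.

   Let X be a poset and colour some of its points by 0, ..., n so that a point
   comparable to all vertices of a simplex of the order complex using all the
   colours is itself coloured.  Then "uses all the colours" is a mod 2
   n-cocycle.  A map I^n -> X given by labels on a cubical grid, constant on
   the boundary, and having an odd number of fully coloured simplices, is not
   null-homotopic.  Indeed a null-homotopy I^(n+1) -> X can be relabelled on a
   fine grid, without changing its boundary values, in such a way that the
   labels of each small cube form a chain, and then the number of fully coloured
   simplices on the boundary is even, as in Sperner's lemma.

   A computation over all cores with at most 8 points finds that each of them is
   disconnected or carries such an odd n-sphere for some n <= 3. *)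

Set Implicit Arguments.
Unset Strict Implicit.
Unset Printing Implicit Defensive.

Import Order.TTheory GRing.Theory Num.Theory.
Import numFieldNormedType.Exports.

(** * Parity of simplices in a triangulated grid *)

Definition xsum (I : Type) (s : seq I) (F : I -> bool) : bool :=
  foldr (fun i b => F i (+) b) false s.

Lemma xsum_add (I : Type) (s : seq I) (F G : I -> bool) :
  xsum s (fun i => F i (+) G i) = xsum s F (+) xsum s G.
Proof. by elim: s => //= i s ->; rewrite addbACA. Qed.

Lemma eq_xsum (I : eqType) (s : seq I) (F G : I -> bool) :
  {in s, F =1 G} -> xsum s F = xsum s G.
Proof.
elim: s => //= i s IHs eqFG; rewrite eqFG ?mem_head // IHs // => j js.
by apply: eqFG; rewrite inE js orbT.
Qed.

Lemma xsum_false (I : eqType) (s : seq I) (F : I -> bool) :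
  {in s, F =1 xpred0} -> xsum s F = false.
Proof. by move=> /eq_xsum ->; elim: s => //= i s ->. Qed.

Lemma xsum_exchange (I J : Type) (s : seq I) (t : seq J) (F : I -> J -> bool) :
  xsum s (fun i => xsum t (F i)) = xsum t (fun j => xsum s (F^~ j)).
Proof.
elim: s => /= [|i s ->]; first by elim: t => //= j t <-.
by rewrite -xsum_add.
Qed.

Lemma xsum_rem (I : eqType) (s : seq I) (x : I) (F : I -> bool) :
  x \in s -> xsum s F = F x (+) xsum (rem x s) F.
Proof.
elim: s => //= y s IHs; rewrite inE eq_sym.
by case: eqP => [-> // | _ /= /IHs ->]; rewrite addbCA.
Qed.

Lemma xsum_rem_uniq (I : eqType) (s : seq I) (x : I) (F : I -> bool) :
  uniq s -> xsum (rem x s) F = xsum s (fun i => (i != x) && F i).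
Proof.
move=> /rem_filter ->; elim: s => //= i s IHs.
by case: eqP => //= _; rewrite IHs.
Qed.

(** The terms at [(i, j)] and [(j, i)] cancel mod 2. *)
Lemma xsum_symmetric (I : eqType) (s : seq I) (F : I -> I -> bool) :
  {in s &, forall i j, F i j = F j i} -> {in s, forall i, F i i = false} ->
  xsum s (fun i => xsum s (F i)) = false.
Proof.
elim: s => //= x s IHs symF diagF.
have xs := mem_head x s; have ss y : y \in s -> y \in x :: s by rewrite inE orbC => ->.
rewrite diagF //= xsum_add (_ : xsum s (F^~ x) = xsum s (F x)).
  rewrite IHs ?addbF ?addbb // => [i j /ss ? /ss ?|i /ss ?]; [exact: symF|exact: diagF].
by apply: eq_xsum => i /ss ?; exact: symF.
Qed.

Lemma xsum_iotaS (F : nat -> bool) (N : nat) :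
  xsum (iota 0 N.+1) F = xsum (iota 0 N) F (+) F N.
Proof.
have -> : iota 0 N.+1 = rcons (iota 0 N) N by rewrite -addn1 iotaD cats1.
by elim: iota => /= [|i s ->]; rewrite ?addbF // addbA.
Qed.

Lemma xsum_telescope (F : nat -> bool) (N : nat) :
  xsum (iota 0 N) (fun i => F i.+1 (+) F i) = F N (+) F 0.
Proof.
elim: N => [|N IHN]; first by rewrite addbb.
by rewrite xsum_iotaS IHN addbC -addbA addKb.
Qed.

(* Only finitely many coordinates matter; unused ones are 0. *)
Definition gpoint := nat -> nat.

Definition update (p : gpoint) (d v : nat) : gpoint :=
  fun i => if i == d then v else p i.

Lemma updateK p d v w : update (update p d v) d w = update p d w.
Proof. by apply/funext => i; rewrite /update; case: eqP. Qed.

Lemma updateC p d v e w : d != e -> update (update p d v) e w = update (update p e w) d v.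
Proof.
move=> /negbTE de; apply/funext => i; rewrite /update.
by case: (i =P e) => // ->; rewrite eq_sym de.
Qed.

(* [p] and [q] are opposite corners of a box and [ds] the directions in which
   they may differ.  [W] is summed over the simplices of the Freudenthal
   triangulation of the box: paths from [p] to [q] along its edges. *)
Fixpoint flagsum (n : nat) (p q : gpoint) (ds : seq nat)
    (W : seq gpoint -> bool) : bool :=
  if n is n'.+1 then
    xsum ds (fun d => flagsum n' (update p d (q d)) q (rem d ds)
                              (fun c => W (p :: c)))
  else W [:: p].

(** The simplicial coboundary mod 2: [W] is summed over the faces of [c], each obtained by deleting
    one entry. *)
Fixpoint coboundary (A : Type) (W : seq A -> bool) (c : seq A) : bool :=
  if c is x :: c' then W c' (+) coboundary (fun b => W (x :: b)) c' else false.

Lemma flagsum_add n p q ds V W :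
  flagsum n p q ds (fun c => V c (+) W c) =
  flagsum n p q ds V (+) flagsum n p q ds W.
Proof.
elim: n p ds V W => //= n IHn p ds V W.
rewrite -xsum_add; apply: eq_xsum => d _; exact: IHn.
Qed.

Lemma flagsum_false n p q ds W : (forall c, W c = false) ->
  flagsum n p q ds W = false.
Proof.
elim: n p ds W => //= n IHn p ds W W0.
by apply: xsum_false => d _; apply: IHn.
Qed.

(* Faces obtained by removing an interior vertex of a path cancel in pairs:
   swapping the two moves around that vertex gives the same face. *)
Lemma flagsum_coboundary n p q ds W : uniq ds -> size ds = n.+1 ->
  flagsum n.+1 p q ds (coboundary W) =
  xsum ds (fun d => flagsum n (update p d (q d)) q (rem d ds) W
                    (+) flagsum n p q (rem d ds) W).
Proof.
elim: n p ds W => [|n IHn] p ds W uds sds.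
  by case: ds uds sds => // d [] // _ _ /=; rewrite !addbF.
have -> : flagsum n.+2 p q ds (coboundary W) =
    xsum ds (fun d => flagsum n.+1 (update p d (q d)) q (rem d ds) W (+)
      flagsum n.+1 (update p d (q d)) q (rem d ds) (coboundary (fun b => W (p :: b)))).
  by apply: eq_xsum => d dds; rewrite -flagsum_add.
rewrite !xsum_add; congr (_ (+) _).
pose Wp b := W (p :: b).
transitivity (xsum ds (fun d => xsum (rem d ds) (fun d' =>
   flagsum n (update (update p d (q d)) d' (q d')) q (rem d' (rem d ds)) Wp)) (+)
  xsum ds (fun d => xsum (rem d ds) (fun d' =>
   flagsum n (update p d (q d)) q (rem d' (rem d ds)) Wp))).
  rewrite -xsum_add; apply: eq_xsum => d dds; rewrite -xsum_add.
  by rewrite IHn ?rem_uniq // size_rem // sds.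
have remC d d' : rem d (rem d' ds) = rem d' (rem d ds).
  rewrite !rem_filter ?filter_uniq // -!filter_predI.
  by apply: eq_filter => i /=; rewrite andbC.
have -> : xsum ds (fun d => xsum (rem d ds) (fun d' =>
   flagsum n (update (update p d (q d)) d' (q d')) q (rem d' (rem d ds)) Wp)) = false.
  under [xsum ds _]eq_xsum => d dds do rewrite xsum_rem_uniq //.
  apply: xsum_symmetric => [d d' _ _|d _]; last by rewrite eqxx.
  by rewrite eq_sym; case: eqP => //= /eqP dd'; rewrite updateC // remC.
rewrite addFb.
under [LHS]eq_xsum => d dds do rewrite xsum_rem_uniq //.
rewrite xsum_exchange; apply: eq_xsum => d dds.
by rewrite /= xsum_rem_uniq //; apply: eq_xsum => d' _; rewrite eq_sym remC.
Qed.

Fixpoint every (A : Type) (P : A -> Prop) (c : seq A) : Prop :=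
  if c is x :: c' then P x /\ every P c' else True.

Definition corner (p q : gpoint) (ds : seq nat) (r : gpoint) : Prop :=
  forall i, r i = p i \/ (i \in ds /\ r i = q i).

Lemma sub_every (A : Type) (P Q : A -> Prop) c :
  (forall x, P x -> Q x) -> every P c -> every Q c.
Proof. by move=> PQ; elim: c => //= x c IHc [/PQ ? /IHc]. Qed.

Lemma eq_flagsum n p q ds V W : uniq ds -> size ds = n ->
  (forall c, size c = n.+1 -> every (corner p q ds) c -> V c = W c) ->
  flagsum n p q ds V = flagsum n p q ds W.
Proof.
elim: n p ds V W => [|n IHn] p ds V W uds sds eqVW.
  by apply: eqVW => //=; split=> // i; left.
apply: eq_xsum => d dds; apply: IHn; rewrite ?rem_uniq ?size_rem ?sds // => c sc Pc.
apply: eqVW => /=; first by rewrite sc.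
split; first by move=> i; left.
apply: sub_every Pc => r rP i.
case: (rP i) => [|[/mem_rem ids ->]]; last by right.
by rewrite /update; case: eqP => [-> ->|_ ->]; [right|left].
Qed.

Lemma flagsum_eqr n p q q' ds W : uniq ds -> size ds = n ->
  {in ds, q =1 q'} -> flagsum n p q ds W = flagsum n p q' ds W.
Proof.
elim: n p ds W => //= n IHn p ds W uds sds eqq.
apply: eq_xsum => d dds; rewrite (eqq d) //; apply: IHn; rewrite ?rem_uniq ?size_rem ?sds //.
by move=> i /mem_rem /eqq.
Qed.

(** Each path uses every direction of [ds], and its move in direction [d] stays in place, so a
    vertex is repeated. *)
Lemma flagsum_degenerate n p q ds d W : uniq ds -> size ds = n ->
  d \in ds -> p d = q d ->
  (forall (c1 c2 : seq gpoint) x, W (c1 ++ x :: x :: c2) = false) ->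
  flagsum n p q ds W = false.
Proof.
elim: n p ds W => [|n IHn] p ds W uds sds dds pqd W0; first by case: ds sds dds {uds}.
apply: xsum_false => e eds; have [ed|ed] := eqVneq e d.
  rewrite {}ed in eds *; rewrite (_ : update p d (q d) = p); last first.
    by apply/funext => i; rewrite /update; case: eqP => // ->.
  have Wpp c : W (p :: p :: c) = false by exact: (W0 [::]).
  case: n sds {IHn} => [|n] sds; first exact: Wpp.
  apply: xsum_false => f _; apply: flagsum_false => c; exact: Wpp.
apply: IHn; rewrite ?rem_uniq ?size_rem ?sds //.
- by rewrite mem_rem_uniq // !inE eq_sym ed.
- by rewrite /update eq_sym (negbTE ed).
- by move=> c1 c2 x; exact: (W0 (p :: c1)).
Qed.

Lemma flagsum_map n p q ds (f : nat -> nat) W :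
  flagsum n p q ds (fun c => W (map (fun r : gpoint => f \o r) c)) =
  flagsum n (f \o p) (f \o q) ds W.
Proof.
elim: n p ds W => //= n IHn p ds W; apply: eq_xsum => d _.
rewrite (IHn _ _ (fun c => W (f \o p :: c))); congr flagsum.
by apply/funext => i; rewrite /update /=; case: eqP.
Qed.

(** * Sums over a cube cut into small cubes *)

Fixpoint gridsum (N : nat) (ds : seq nat) (p q : gpoint)
    (F : gpoint -> gpoint -> bool) : bool :=
  if ds is d :: ds' then
    xsum (iota 0 N) (fun i => gridsum N ds' (update p d i) (update q d i.+1) F)
  else F p q.

Definition unit_box (N : nat) (ds : seq nat) (p q p' q' : gpoint) : Prop :=
  forall d, if d \in ds then p' d < N /\ q' d = (p' d).+1
            else p' d = p d /\ q' d = q d.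

Lemma eq_gridsum N ds p q F G : uniq ds ->
  (forall p' q', unit_box N ds p q p' q' -> F p' q' = G p' q') ->
  gridsum N ds p q F = gridsum N ds p q G.
Proof.
elim: ds p q => /= [|d ds IHds] p q; first by move=> _; apply=> d.
move=> /andP[dds uds] eqFG; apply: eq_xsum => i; rewrite mem_iota /= => iN.
apply: IHds => // p' q' boxpq; apply: eqFG => e; move: (boxpq e); rewrite inE.
rewrite /update; case: (e =P d) => [->|//]; rewrite (negbTE dds) /=.
by move=> [-> ->].
Qed.

Lemma gridsum_xsum N ds p q (I : eqType) (s : seq I) F :
  gridsum N ds p q (fun p q => xsum s (F p q)) =
  xsum s (fun i => gridsum N ds p q (fun p q => F p q i)).
Proof.
elim: ds p q => //= d ds IHds p q.
by rewrite xsum_exchange; apply: eq_xsum => i _; exact: IHds.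
Qed.

Lemma gridsum_false N ds p q F : (forall p q, F p q = false) ->
  gridsum N ds p q F = false.
Proof.
move=> F0; elim: ds p q => //= d ds IHds p q.
by apply: xsum_false => i _; exact: IHds.
Qed.

Lemma gridsum_update N ds d v w p q F : d \notin ds ->
  gridsum N ds (update p d v) (update q d w) F =
  gridsum N ds p q (fun p q => F (update p d v) (update q d w)).
Proof.
elim: ds p q => //= e ds IHds p q; rewrite inE negb_or => /andP[de dds].
by apply: eq_xsum => i _; rewrite updateC // (updateC q) // IHds.
Qed.

(** Direction [d] is moved inside all the others, ready to be telescoped. *)
Lemma gridsum_out N ds d p q F : uniq ds -> d \in ds ->
  gridsum N ds p q F =
  gridsum N (rem d ds) p q
    (fun p q => xsum (iota 0 N) (fun i => F (update p d i) (update q d i.+1))).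
Proof.
elim: ds p q => //= e ds IHds p q /andP[eds uds]; rewrite inE eq_sym.
case: (eqVneq e d) eds => [-> dds _|ed eds /= dds].
  by rewrite gridsum_xsum; apply: eq_xsum => i _; rewrite gridsum_update.
by apply: eq_xsum => i _; exact: IHds.
Qed.

(** A Stokes formula mod 2: walls between adjacent small cubes cancel, and only the pairs of
    opposite faces of the large cube remain. *)
Lemma gridsum_coboundary N n ds p q W : uniq ds -> size ds = n.+1 ->
  gridsum N ds p q (fun p q => flagsum n.+1 p q ds (coboundary W)) =
  xsum ds (fun d => gridsum N (rem d ds) p q (fun p q =>
    flagsum n (update p d N) q (rem d ds) W (+)
    flagsum n (update p d 0) q (rem d ds) W)).
Proof.
move=> uds sds.
pose F d (p q : gpoint) := flagsum n (update p d (q d)) q (rem d ds) W (+)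
                flagsum n p q (rem d ds) W.
transitivity (gridsum N ds p q (fun p q => xsum ds (fun d => F d p q))).
  by apply: eq_gridsum => // p' q' _; exact: flagsum_coboundary.
rewrite gridsum_xsum; apply: eq_xsum => d dds; rewrite (gridsum_out _ _ _ _ uds dds).
apply: eq_gridsum; rewrite ?rem_uniq // => p' q' _.
rewrite -(xsum_telescope (fun i => flagsum n (update p' d i) q' (rem d ds) W)).
apply: eq_xsum => i _; rewrite /F updateK {2}/update eqxx.
by congr (_ (+) _); apply: flagsum_eqr; rewrite ?rem_uniq ?size_rem ?sds // => e;
  rewrite mem_rem_uniq // inE /update => /andP[/negbTE ->].
Qed.

(** Where [s] stands still the term is some [F a a] and vanishes; the unit jumps remain, one for
    each value below [s N]. *)
Lemma xsum_reindex (F : nat -> nat -> bool) (s : nat -> nat) N :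
  (forall a, F a a = false) -> s 0 = 0 ->
  (forall i, i < N -> s i.+1 = s i \/ s i.+1 = (s i).+1) ->
  xsum (iota 0 N) (fun i => F (s i) (s i.+1)) =
  xsum (iota 0 (s N)) (fun j => F j j.+1).
Proof.
move=> F0 s0; elim: N => [|N IHN] sS; first by rewrite s0.
rewrite xsum_iotaS IHN => [|i /ltnW]; last exact: sS.
by case: (sS N) => // ->; rewrite ?F0 ?addbF // xsum_iotaS.
Qed.

(** Refining a grid keeps the parity, since small cubes flattened by [s] contribute nothing. *)
Lemma gridsum_reindex N K (s : nat -> nat) ds p q (F : gpoint -> gpoint -> bool) :
  s 0 = 0 -> s N = K ->
  (forall i, i < N -> s i.+1 = s i \/ s i.+1 = (s i).+1) ->
  uniq ds ->
  (forall p q d, d \in ds -> p d = q d -> F p q = false) ->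
  gridsum N ds p q (fun p q => F (s \o p) (s \o q)) =
  gridsum K ds (s \o p) (s \o q) F.
Proof.
move=> s0 sN sS; elim: ds p q => //= d ds IHds p q /andP[dds uds] F0.
have comp_update (r : gpoint) j : s \o update r d j = update (s \o r) d (s j).
  by apply/funext => i; rewrite /update /=; case: eqP.
pose G a b := gridsum (s N) ds (update (s \o p) d a) (update (s \o q) d b) F.
rewrite -sN -(@xsum_reindex G) // /G.
  apply: eq_xsum => i _; rewrite -!comp_update sN; apply: IHds => // p' q' e eds.
  by apply: F0; rewrite inE eds orbT.
move=> a; rewrite gridsum_update //; apply: gridsum_false => p' q'.
by apply: (F0 _ _ d); rewrite ?mem_head // /update !eqxx.
Qed.

(** * Certificates for finite posets *)

(* [nth false (nth [::] s j) i] tells whether point i < j lies strictly below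
   point j; the numbering is thus a linear extension of the order. *)
Definition poset := seq (seq bool).

Definition ple (s : poset) (i j : nat) : bool :=
  (i == j) || nth false (nth [::] s j) i.

Definition pcmp (s : poset) (i j : nat) : bool := ple s i j || ple s j i.

Fixpoint grid (R : nat -> seq nat) (ds : seq nat) (p : gpoint) : seq gpoint :=
  if ds is d :: ds' then flatten [seq grid R ds' (update p d v) | v <- R d]
  else [:: p].

(* Colours above n stand for uncoloured points. *)
Definition full (n : nat) (col : nat -> nat) (c : seq nat) : bool :=
  perm_eq (map col c) (iota 0 n.+1).

(** Backtracking over the choices of one point for each colour in [cs]; [acc] holds the mutually
    comparable points chosen so far. *)
Fixpoint closed_colouring_rec (s : poset) (n : nat) (col : nat -> nat)
    (cs acc : seq nat) : bool :=
  if cs is c :: cs' then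
    all (fun a => if (col a == c) && all (pcmp s a) acc then
                    closed_colouring_rec s n col cs' (a :: acc) else true)
        (iota 0 (size s))
  else all (fun z => all (pcmp s z) acc ==> (col z <= n)) (iota 0 (size s)).

Definition closed_colouring s n col :=
  closed_colouring_rec s n col (iota 0 n.+1) [::].

Definition origin : gpoint := fun=> 0.

(* The cells of a subdivided interval, numbered along a Khalimsky line: even
   numbers are vertices (closed points) and odd ones edges (open points).  This
   is the minimal open neighbourhood of cell j. *)
Definition near_range (K j : nat) : seq nat :=
  if odd j then [:: j] else [seq i <- [:: j.-1; j; j.+1] | i <= K].

(* Certificate for an essential map from the n-cube divided in k ^ n small cubes:
   the open cell with Khalimsky coordinates p is sent to the point [l p].  The
   conditions are: constant value x on the boundary; continuity; chains on the
   small cubes of the barycentric subdivision; [full] is a cocycle; and the map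
   has an odd number of fully coloured simplices. *)
Definition spherical (s : poset) (n : nat) (col : nat -> nat) (k x : nat)
    (l : gpoint -> nat) : bool :=
  let ds := iota 0 n in let K := k.*2 in
  [&& 0 < n, 0 < k, x < size s,
      all (fun p => (l p < size s) &&
          (has (fun d => (p d == 0) || (p d == K)) ds ==> (l p == x)))
        (grid (fun=> iota 0 K.+1) ds origin),
      all (fun p => let a := l p in all (fun q => ple s (l q) a)
          (grid (fun d => near_range K (p d)) ds origin))
        (grid (fun=> iota 0 K.+1) ds origin),
      all (fun p => let c := map l (grid (fun d => [:: p d; (p d).+1]) ds origin) in
          all (fun a => all (pcmp s a) c) c)
        (grid (fun=> iota 0 K) ds origin),
      closed_colouring s n col &
      gridsum K ds origin origin (fun p q =>
        flagsum n p q ds (fun c => full n col (map l c)))].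

Definition disconnected (s : poset) (A : nat -> bool) : bool :=
  [&& all (fun i => all (fun j => pcmp s i j ==> (A i == A j)) (iota 0 (size s)))
        (iota 0 (size s)),
      has A (iota 0 (size s)) & has (predC A) (iota 0 (size s))].

Definition component (s : poset) (S : seq nat) (x : nat) : seq nat :=
  iter (size s) (fun C => [seq y <- S | (y \in C) || has (pcmp s y) C]) [:: x].

(** Breadth-first search: [paths] is the current layer, each path with its newest point first. *)
Fixpoint shortest_path (s : poset) (fuel : nat) (S T : seq nat)
    (paths : seq (seq nat)) : seq nat :=
  if fuel is fuel'.+1 then
    let i := find (fun c => head 0 c \in T) paths in
    if i < size paths then nth [::] paths i else
    let seen := map (head 0) paths in
    let S' := [seq y <- S | y \notin seen] in
    let new := [seq y <- S' | has (pcmp s y) seen] in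
    shortest_path s fuel' S' T
      [seq y :: nth [::] paths (find (fun c => pcmp s y (head 0 c)) paths) | y <- new]
  else [::].

(* A point m, a component U of its link in Y (which is useful when this link is
   disconnected), and a loop leaving m through U and coming back outside U.
   Colouring m by 1 and U by 0 gives a cocycle with value 1 on this loop.  The
   search procedures need no correctness proof: their results are checked by
   [spherical]. *)
Definition loops (s : poset) (Y : seq nat) : seq (nat * seq nat * seq nat) :=
  flatten [seq
    let L := [seq y <- Y | (y != m) && pcmp s y m] in
    pmap (fun y =>
      let U := component s L y in
      let c := shortest_path s (size s) (rem m Y)
                 [seq z <- L | z \notin U] [:: [:: y]] in
      if c is [::] then None else Some (m, U, m :: c)) L
  | m <- Y].

(* The map on cells determined by labels h of the vertices: a cell goes to the
   least label of its vertices. *)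
Definition lower_label (s : poset) (n : nat) (h : gpoint -> nat) (j : gpoint) : nat :=
  (fix low ds p := if ds is d :: ds' then
     let a := low ds' (update p d (j d)./2) in
     let b := low ds' (update p d (uphalf (j d))) in if ple s a b then a else b
   else h p) (iota 0 n) origin.

(** The default value [m] of [nth] closes the loop. Eight edges suffice when [s] has at most 8
    points, as [c] has no repetition. Colour 9 means uncoloured. *)
Definition find_circle (s : poset) : bool :=
  if loops s (iota 0 (size s)) is (m, U, c) :: _ then
    spherical s 1 (fun i => if i == m then 1 else if i \in U then 0 else 9) 8 m
      (lower_label s 1 (fun p => nth m c (p 0)))
  else false.

(** Distance to the centre [(r, ..., r)] in the maximum norm; one of the two truncated differences
    is always 0. *)
Definition radius (n r : nat) (p : gpoint) :=
  foldr (fun d => maxn ((p d - r) + (r - p d))) 0 (iota 0 n).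

(* Position, from 0 to 15, along the boundary of the square [1, 5] x [1, 5]. *)
Definition ring_index (p : gpoint) : nat :=
  if p 0 == 1 then (p 1).-1 else if p 1 == 5 then 3 + p 0
  else if p 0 == 5 then 13 - p 1 else 17 - p 0.

(* Suspension of a loop from two points u and v comparable to all others: v in the
   middle of the square, u outside and the loop on a ring in between.  The loop
   is slowed down by a factor 2 so that it does not move at the corners. *)
Definition find_sphere2 (s : poset) : bool :=
  has (fun u => if [seq v <- iota 0 (size s) | ~~ pcmp s u v] is [:: v] then
    let Y := [seq y <- iota 0 (size s) | (y != u) && (y != v)] in
    if loops s Y is (m, U, c) :: _ then
      spherical s 2 (fun i => if i == u then 2 else if i == m then 1 else
                              if i \in U then 0 else 9) 6 u
      (lower_label s 2 (fun p => match radius 2 3 p with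
          2 => nth m c (ring_index p)./2 | 3 => u | _ => v end))
    else false else false) (iota 0 (size s)).

(* The only core to consider here is the join of four pairs of points.  The cube
   has 6 in the middle and 7 outside, and the shell in between is mapped to the
   other three pairs by the last nonzero coordinate (from the centre). *)
Definition find_sphere3 (s : poset) : bool :=
  spherical s 3 (nth 9 [:: 9; 0; 9; 1; 9; 2; 9; 3]) 4 7
    (lower_label s 3 (fun p => match radius 3 2 p with
      | 0 => 6
      | 1 => if p 2 != 2 then 4 + (2 < p 2) else
             if p 1 != 2 then 2 + (2 < p 1) else 2 < p 0
      | _ => 7
      end)).

Definition up_beat (s : poset) : bool :=
  has (fun x => has (fun y => [&& y != x, ple s x y &
    all (fun z => (z != x) && ple s x z ==> ple s y z) (iota 0 (size s))])
    (iota 0 (size s))) (iota 0 (size s)).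

(* Conditionals are used here and below because [vm_compute] evaluates both
   arguments of the boolean connectives. *)
Definition non_trivial (s : poset) : bool :=
  let A := component s (iota 0 (size s)) 0 in
  if disconnected s (fun i => i \in A) then true else
  if find_circle s then true else
  if find_sphere2 s then true else find_sphere3 s.

Fixpoint bitlists (k : nat) : seq (seq bool) :=
  if k is k'.+1 then
    [seq true :: b | b <- bitlists k'] ++ [seq false :: b | b <- bitlists k']
  else [:: [::]].

(* [D] is a down-set without a greatest element, i.e. the new point is not a down
   beat point; the first condition only reduces the number of orderings of the
   same poset. *)
Definition extends (s : poset) (D : seq bool) : bool :=
  let I := iota 0 (size s) in
  [&& count id (last [::] s) <= count id D,
      all (fun i => nth false D i ==>
        all (fun j => nth false (nth [::] s i) j ==> nth false D j) I) I &
      all (fun i => nth false D i ==>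
        has (fun j => nth false D j && ~~ ple s j i) I) I].

(** New points never lie below old ones, so [extends] can exclude down beat points once and for all.
    An up beat point may cease to be one when points are added above it; such posets are accepted
    here and still extended by [explore]. *)
Definition settled (s : poset) : bool :=
  if size s <= 1 then true else if up_beat s then true else non_trivial s.

Fixpoint explore (fuel : nat) (s : poset) : bool :=
  if settled s then if fuel is fuel'.+1 then
    all (fun D => if extends s D then explore fuel' (rcons s D) else true)
        (bitlists (size s))
    else true
  else false.

(** * Soundness of the certificates *)

Lemma all_grid R ds p (P : pred gpoint) q : all P (grid R ds p) ->
  (forall d, if d \in ds then q d \in R d else q d == p d) -> P q.
Proof.
elim: ds p => [|d ds IHds] p /=.
  by rewrite andbT => Pp qp; rewrite (_ : q = p) //; apply/funext => d; exact/eqP/qp.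
have -> ss : all P (flatten ss) = all (all P) ss.
  by elim: ss => //= c ss IHss; rewrite all_cat IHss.
rewrite all_map => /allP allR qR.
have qd : q d \in R d by have := qR d; rewrite mem_head.
apply: (IHds (update p d (q d))); first exact: allR.
move=> e; have := qR e; rewrite inE /update.
by case: (e =P d) => [->|//] _; case: ifP.
Qed.

Lemma map_grid R ds p (l : gpoint -> nat) q :
  (forall d, if d \in ds then q d \in R d else q d == p d) ->
  l q \in map l (grid R ds p).
Proof.
apply: (@all_grid _ _ _ (fun q => l q \in map l (grid R ds p))).
have sub (t : seq nat) u : (forall i, (i \in map l u) -> i \in t) ->
    all (fun q => l q \in t) u.
  by elim: u => //= r u IHu ut; rewrite ut ?mem_head // IHu // => i iu;
    apply: ut; rewrite inE iu orbT.
exact: sub.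
Qed.

Lemma coboundary_map (A B : Type) (f : A -> B) (W : seq B -> bool) (c : seq A) :
  coboundary (fun c => W (map f c)) c = coboundary W (map f c).
Proof. by elim: c W => //= x c IHc W; rewrite -IHc. Qed.

(** Up to permutation, deleting an entry amounts to deleting the first occurrence of its value. The
    prefix [b] in the proof collects the entries already passed. *)
Lemma coboundary_perm (I : eqType) (t c : seq I) :
  coboundary (fun c => perm_eq c t) c = xsum c (fun x => perm_eq (rem x c) t).
Proof.
suff gen (b : seq I) : coboundary (fun c => perm_eq (b ++ c) t) c =
    xsum c (fun x => perm_eq (b ++ rem x c) t) by exact: (gen [::]).
elim: c b => //= x c IHc b; rewrite eqxx; congr (_ (+) _).
have := IHc (rcons b x); under eq_fun do rewrite cat_rcons; move=> ->.
apply: eq_xsum => y yc; rewrite cat_rcons; case: (x =P y) => // ->.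
have: perm_eq (b ++ y :: rem y c) (b ++ c) by rewrite perm_cat2l perm_sym perm_to_rem.
by move/permPl.
Qed.

Lemma xsum_count (I : eqType) (c : seq I) (x : I) :
  xsum c (pred1 x) = odd (count_mem x c).
Proof. by elim: c => //= y c ->; rewrite oddD; case: (y == x). Qed.

(** Sperner's pairing: if deleting [x] leaves each colour once, then the colour of [x], being at
    most [n], occurs exactly twice in [c], and exactly two faces are full. *)
Lemma coboundary_full n col (c : seq nat) :
  (forall x, x \in c -> full n col (rem x c) -> col x <= n) ->
  coboundary (full n col) c = false.
Proof.
move=> col_le; pose t := iota 0 n.+1.
have -> : coboundary (full n col) c = coboundary (fun c => perm_eq c t) (map col c).
  by rewrite -coboundary_map.
rewrite coboundary_perm.
have [/hasP[x xc xt]|/hasPn xt] :=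
    boolP (has (fun x => perm_eq (rem (col x) (map col c)) t) c); last first.
  by apply: xsum_false => _ /mapP[x xc ->]; apply/negbTE/xt.
have cx : perm_eq (map col c) (col x :: t).
  by rewrite (perm_trans (perm_to_rem (map_f col xc))) // perm_cons.
rewrite (@eq_xsum _ _ _ (pred1 (col x))) => [|y yc]; last first.
  apply/idP/eqP => [yt|-> //]; apply/eqP.
  have yt' : perm_eq (y :: t) (col x :: t).
    by rewrite -(permPr cx) perm_sym (permPl (perm_to_rem yc)) perm_cons.
  have /permP/(_ (pred1 y)) /= := yt'; rewrite eqxx.
  by case: (eqVneq (col x) y) => // ne /eqP; rewrite eqn_add2r.
suff ct : count_mem (col x) t = 1.
  by rewrite xsum_count (permP cx) -cat1s count_cat ct /= eqxx.
rewrite count_uniq_mem ?iota_uniq // mem_iota add0n ltnS col_le //.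
rewrite /full; apply: perm_trans xt; rewrite -(perm_cons (col x)).
by rewrite -map_cons -(permPr (perm_to_rem (map_f col xc))) perm_map // perm_sym perm_to_rem.
Qed.

Lemma pcmp_sym s a b : pcmp s a b = pcmp s b a.
Proof. by rewrite /pcmp orbC. Qed.

Lemma pcmp_refl s a : pcmp s a a.
Proof. by rewrite /pcmp /ple eqxx. Qed.

Lemma closed_colouring_recP s n col cs acc b z :
  closed_colouring_rec s n col cs acc -> z < size s ->
  all (pcmp s z) acc -> map col b = cs -> all (fun a => a < size s) b ->
  all (fun a => pcmp s z a && all (pcmp s a) acc && all (pcmp s a) b) b ->
  col z <= n.
Proof.
move=> + zs; elim: cs acc b => [|c cs IHcs] acc [] //=.
  move=> /allP/(_ z); rewrite mem_iota zs => /(_ isT) cz zacc _ _ _.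
  by rewrite zacc in cz.
move=> a b /allP ca zacc [colac bcs] /andP[a_s bs].
move=> /andP[/andP[/andP[za a_acc] _] b_cmp].
have := ca a; rewrite mem_iota a_s colac eqxx a_acc => /(_ isT) /IHcs; apply; last 3 first.
- exact: bcs.
- exact: bs.
- apply: sub_all b_cmp => y /= /andP[/andP[-> ->] /andP[-> ->]]; by [].
- by rewrite /= za.
Qed.

Lemma closed_colouringP s n col (c : seq nat) :
  closed_colouring s n col -> all (fun a => a < size s) c ->
  {in c &, forall a b, pcmp s a b} -> coboundary (full n col) c = false.
Proof.
move=> cc /allP cs ccmp; apply: coboundary_full => z zc zfull.
(* Sorting by colour puts the remaining points in the order in which the search chooses them. *)
have [b bperm bcol] : exists2 b, perm_eq b (rem z c) & map col b = iota 0 n.+1.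
  have le_tot : total (fun a b => col a <= col b) by move=> a b; exact: leq_total.
  exists (sort (fun a b => col a <= col b) (rem z c)); first by rewrite perm_sort.
  apply: (@sorted_eq _ leq leq_trans anti_leq).
  - by rewrite sorted_map sort_sorted.
  - exact: iota_sorted.
  - by apply: perm_trans zfull; rewrite perm_map // perm_sort.
have bc a : a \in b -> a \in c by rewrite (perm_mem bperm) => /mem_rem.
apply: (@closed_colouring_recP s n col (iota 0 n.+1) [::] b z) => //.
- exact: cs.
- by apply/allP => a /bc/cs.
- apply/allP => a /bc ac; rewrite ccmp //=; apply/allP => d /bc dc; exact: ccmp.
Qed.

(* Khalimsky coordinate of v / M. *)
Definition cell_index (M v : nat) : nat := (v %/ M).*2 + ~~ (M %| v).

Lemma cell_index0 M : cell_index M 0 = 0.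
Proof. by rewrite /cell_index div0n dvdn0. Qed.

Lemma cell_index_mul M k : 0 < M -> cell_index M (k * M) = k.*2.
Proof. by move=> M0; rewrite /cell_index mulnK // dvdn_mull // addn0. Qed.

(** With [1 < M] each edge has a grid point in its interior, so no odd index is skipped. *)
Lemma cell_indexS M v : 1 < M ->
  cell_index M v.+1 = cell_index M v \/ cell_index M v.+1 = (cell_index M v).+1.
Proof.
move=> M1; rewrite /cell_index divnS ?(ltnW M1) //.
case: (boolP (M %| v.+1)) => Mv1.
  rewrite (_ : M %| v = false); first by right; rewrite /= doubleD; lia.
  by apply: contraTF Mv1 => Mv; rewrite -addn1 dvdn_addr // dvdn1; lia.
by rewrite add0n; case: (M %| v) => /=; [right|left]; lia.
Qed.

Lemma cell_index_le M v w : 1 < M -> v <= w -> cell_index M v <= cell_index M w.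
Proof.
move=> M1 /subnK <-; elim: (w - v) => // i IHi; rewrite addSn.
by have [->|->] := cell_indexS (i + v) M1; last exact: leqW.
Qed.

Definition in_unit_box (m : nat) (b p : gpoint) : Prop :=
  forall d, if d < m then p d = b d \/ p d = (b d).+1 else p d = 0.

(** The count on the boundary of the cube of dimension [n + 1] is even by the cocycle property.
    However, the bottom face, which refines [l], contributes an odd number, and the other faces,
    labelled by [x] alone, contribute nothing. *)
Theorem spherical_not_filled s n col k x l M (L : gpoint -> nat) :
  spherical s n col k x l -> 1 < M ->
  (forall p, (forall d, if d <= n then p d <= k * M else p d == 0) -> L p < size s) ->
  (forall b p q, (forall d, d <= n -> b d < k * M) ->
     in_unit_box n.+1 b p -> in_unit_box n.+1 b q -> pcmp s (L p) (L q)) ->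
  (forall p, (forall d, if d < n then p d <= k * M else p d == 0) ->
     L p = l (cell_index M \o p)) ->
  (forall p, (forall d, if d <= n then p d <= k * M else p d == 0) ->
     p n = k * M \/ (exists2 d, d < n & p d = 0 \/ p d = k * M) -> L p = x) ->
  False.
Proof.
move=> /= /and5P[n0 k0 xs lbdry /and4P[lmono lchain lcol lodd]] M1 Ls Lcmp Lbot Lbdry.
set N := k * M in Ls Lcmp Lbot Lbdry.
have N0 : 0 < N by rewrite muln_gt0 k0 (ltnW M1).
pose ds := iota 0 n.+1; have uds : uniq ds := iota_uniq 0 n.+1.
have sds : size ds = n.+1 by rewrite size_iota.
have mem_ds d : (d \in ds) = (d <= n) by rewrite mem_iota.
pose W c := full n col (map L c).
have := gridsum_coboundary N origin origin W uds sds.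
(* On each small cube the labels form a chain, where the coboundary of [full] vanishes. *)
have -> : gridsum N ds origin origin (fun p q => flagsum n.+1 p q ds (coboundary W)) = false.
  rewrite -(gridsum_false N ds origin origin (F := fun _ _ => false)) //.
  apply: eq_gridsum => // p q boxpq.
  rewrite -(@flagsum_false n.+1 p q ds (fun=> false)) //; apply: eq_flagsum => // c _ cpq.
  rewrite /W coboundary_map.
  have pN d : d <= n -> p d < N /\ q d = (p d).+1.
    by move=> dn; have := boxpq d; rewrite mem_ds dn.
  have pO d : (d <= n) = false -> p d = 0.
    by move=> dn; have := boxpq d; rewrite mem_ds dn => -[].
  have {cpq}: every (in_unit_box n.+1 p) c.
    apply: sub_every cpq => r rpq d; rewrite ltnS; case: (rpq d).
      by case: ifP => [_ ->|/pO -> ->]; [left|].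
    by rewrite mem_ds => -[dn ->]; rewrite dn; have [_ ->] := pN d dn; right.
  move=> cbox; apply: (closed_colouringP lcol).
    elim: c cbox => //= r c IHc [rbox /IHc ->]; rewrite andbT; apply: Ls => d.
    have := rbox d; rewrite ltnS; case: ifP => dn; last by move/eqP.
    by have [pdN _] := pN d dn; move=> [->|->] //; exact: ltnW.
  have cmp1 r : in_unit_box n.+1 p r -> forall c, every (in_unit_box n.+1 p) c ->
      {in map L c, forall b, pcmp s (L r) b}.
    move=> rbox; elim=> //= r' c' IHc [r'box c'box] b; rewrite inE => /predU1P[->|].
      by apply: Lcmp rbox r'box => d dn; have [] := pN d dn.
    exact: IHc.
  have : {in map L c, forall a, exists2 r, in_unit_box n.+1 p r & a = L r}.
    elim: c cbox {cmp1} => //= r c IHc [rbox cbox] a; rewrite inE.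
    by move=> /predU1P[->|/IHc]; [exists r|exact].
  by move=> ex a b /ex[r rbox ->]; exact: cmp1.
have rem_n : rem n ds = iota 0 n.
  rewrite /ds -addn1 iotaD add0n cats1.
  have : n \notin iota 0 n by rewrite mem_iota ltnn andbF.
  by elim: iota => /= [|d t IHt]; rewrite ?eqxx // inE negb_or eq_sym => /andP[/negbTE -> /IHt ->].
have full_const c : size c = n.+1 -> (every (fun r => L r = x) c) -> W c = false.
  move=> sc cx; rewrite /W (_ : map L c = nseq n.+1 x); last first.
    by rewrite -{}sc; elim: c cx => //= r c IHc [-> /IHc ->].
  rewrite /full map_nseq; apply/negP => /perm_uniq.
  by rewrite iota_uniq -(prednK n0) /= inE eqxx.
move/esym; rewrite (xsum_rem _ (x := n)) ?mem_ds //.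
(* Both faces in a direction [d < n] carry the constant label [x]. *)
rewrite [xsum (rem n ds) _]xsum_false => [|d]; last first.
  rewrite rem_n mem_iota /= add0n => dn.
  rewrite -(gridsum_false N (rem d ds) origin origin (F := fun _ _ => false)) //.
  have urd : uniq (rem d ds) by rewrite rem_uniq.
  have mem_r e : (e \in rem d ds) = (e != d) && (e <= n).
    by rewrite mem_rem_uniq // -mem_ds.
  apply: eq_gridsum => // p q boxpq.
  have srd : size (rem d ds) = n by rewrite size_rem ?sds // mem_ds ltnW.
  have bd v : v = 0 \/ v = N -> flagsum n (update p d v) q (rem d ds) W = false.
    move=> v0N; rewrite -(@flagsum_false n (update p d v) q (rem d ds) (fun=> false)) //.
    apply: eq_flagsum => // c sc cpq; apply: full_const => //.
    apply: sub_every cpq => r rpq; apply: Lbdry; last first.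
      right; exists d => //; case: (rpq d) => [->|[]]; first by rewrite /update eqxx.
      by rewrite mem_r eqxx.
    move=> e; have := boxpq e; have := rpq e; rewrite mem_r /update.
    case: (e =P d) => [->|_] /=; first by move=> [-> _|[] //]; rewrite ltnW //; case: v0N => ->.
    case: ifP => en; first by move=> [->|[_ ->]] [peN qe]; rewrite ?qe // ltnW.
    by move=> [->|[] //] [-> _].
  by rewrite !bd //; [left|right].
rewrite addbF rem_n => bot.
suff : gridsum N (iota 0 n) origin origin (fun p q =>
    flagsum n (update p n N) q (iota 0 n) W (+) flagsum n (update p n 0) q (iota 0 n) W) = true.
  by rewrite bot.
rewrite -{}lodd.
pose F p q := flagsum n p q (iota 0 n) (fun c => full n col (map l c)).
rewrite -[LHS]/(gridsum _ _ _ _ _) -/F.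
have -> : origin = cell_index M \o origin by apply/funext => d; rewrite /= cell_index0.
(* Rounding by [cell_index M] maps the fine grid onto the coarse grid of the certificate. *)
rewrite -(@gridsum_reindex N k.*2 (cell_index M) (iota 0 n) origin origin F)
  ?iota_uniq //; first last.
- move=> p q d dn pqd; apply: (flagsum_degenerate (d := d)); rewrite ?iota_uniq ?size_iota //.
  move=> c1 c2 r; apply/negP => /perm_uniq; rewrite iota_uniq !map_cat cat_uniq.
  by rewrite /= inE eqxx /= !andbF.
- by move=> i _; exact: cell_indexS.
- exact: cell_index_mul (ltnW M1).
- exact: cell_index0.
rewrite (_ : cell_index M \o origin = origin); last by apply/funext => d; rewrite /= cell_index0.
apply: eq_gridsum; first exact: iota_uniq.
move=> p q boxpq.
have pN d : d < n -> p d < N /\ q d = (p d).+1.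
  by move=> dn; have := boxpq d; rewrite mem_iota dn.
have pO d : (d < n) = false -> p d = 0 /\ q d = 0.
  by move=> dn; have := boxpq d; rewrite mem_iota dn.
(* The top face is constant as well. *)
have -> : flagsum n (update p n N) q (iota 0 n) W = false.
  rewrite -(@flagsum_false n (update p n N) q (iota 0 n) (fun=> false)) //.
  apply: eq_flagsum => [||c sc cpq]; rewrite ?iota_uniq ?size_iota //.
  apply: full_const => //; apply: sub_every cpq => r rpq; apply: Lbdry; last first.
    left; case: (rpq n) => [->|[]]; first by rewrite /update eqxx.
    by rewrite mem_iota ltnn andbF.
  move=> e; have := rpq e; rewrite mem_iota /update /= add0n.
  have [->|en] := eqVneq e n; first by rewrite leqnn ltnn => -[->|[]].
  rewrite [e <= n]leq_eqVlt (negbTE en) /=.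
  by case: ifP => [/pN[? ->] [->|[_ ->]] //|/pO[-> _] [->|[]] //]; exact: ltnW.
rewrite addFb (_ : update p n 0 = p); last first.
  by apply/funext => d; rewrite /update; case: eqP => // ->; have [] := pO n (ltnn n).
rewrite /F -flagsum_map; apply: eq_flagsum => [||c sc cpq]; rewrite ?iota_uniq ?size_iota //.
rewrite /W -map_comp; congr (full n col _).
elim: c {sc} cpq => //= r c IHc [rpq /IHc ->]; rewrite Lbot // => d.
have := rpq d; rewrite mem_iota /= add0n.
by case: ifP => [/pN[? ->] [->|[_ ->]] //|/pO[-> _] [->|[]] //]; exact: ltnW.
Qed.

(** * Discretization of maps into finite posets *)

Local Open Scope classical_set_scope.
Local Open Scope ring_scope.

(* The labels g are found by decreasing induction on t: g is first defined near
   the points with label > t, and the points of label t not yet covered form a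
   set with a uniform neighbourhood on which f <= t. *)
Lemma discretization (R : realType) (M : pseudoMetricType R) (K : set M)
    (le : rel nat) (m : nat) (f : M -> nat) :
  compact K -> reflexive le -> (forall i j, le i j -> (i <= j)%N) ->
  (forall z, f z < m)%N ->
  (forall z, K z -> \forall w \near z, le (f w) (f z)) ->
  exists (g : M -> nat) (e : R), [/\ 0 < e,
    forall p, K p -> (g p < m)%N,
    forall p q, K p -> ball p e q -> le (f q) (g p) &
    forall p q, K p -> K q -> ball p e q -> le (g p) (g q) || le (g q) (g p)].
Proof.
move=> cK le_refl le_leq fm f_usc.
pose N t e p := exists z, [/\ K z, (t <= f z)%N & ball z e p].
suff step t : (t <= m)%N -> exists (g : M -> nat) (e : R), [/\ 0 < e,
    forall p, K p -> N t e p -> (g p < m)%N,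
    forall p q, K p -> N t e p -> ball p e q -> le (f q) (g p) &
    forall p q, K p -> K q -> N t e p -> N t e q -> ball p e q ->
      le (g p) (g q) || le (g q) (g p)].
  have [g [e [e0 gm fg gg]]] := step 0%N (leq0n m).
  have KN p : K p -> N 0%N e p by exists p; split=> //; exact: ballxx.
  exists g, e; split=> // [p Kp|p q Kp|p q Kp Kq].
  - by apply: gm => //; exact: KN.
  - by apply: fg => //; exact: KN.
  - by apply: gg => //; exact: KN.
move=> /subnK; move: (m - t)%N => d; elim: d t => [|d IHd] t dt.
  have nN p : ~ N t 1 p by move=> [z [_ + _]]; rewrite -[t]add0n dt leqNgt fm.
  by exists f, 1; split=> // [p q _ Np|p q _ _ Np]; case: (nN p Np).
have [g [e [e0 gm fg gg]]] := IHd t.+1 (eq_trans (addnS d t) dt).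
have tm : (t < m)%N by rewrite -dt addSn ltnS leq_addl.
have e20 : 0 < e / 2 by rewrite divr_gt0.
(* By compactness, the points of label [t] that are not well inside the region already treated have
   a common radius on which [f] stays below [t]. *)
have [del del0 delP] : exists2 del, 0 < del & forall z, K z -> f z = t ->
    N t.+1 (e / 2) z \/ forall q, ball z del q -> le (f q) t.
  pose P del z := f z = t -> N t.+1 (e / 2) z \/ forall q, ball z del q -> le (f q) t.
  have : \forall del \near 0^'+, K `<=` P del.
    apply: ((compact_near_coveringP K).1 cK R (0^'+) P) => z Kz.
    have [fzt|fzt] := eqVneq (f z) t; last first.
      case: (ltnP t (f z)) => [tfz|fzt'].
        near=> z' del => _; left; exists z; split=> //.
        by near: z'; exact: near_ball.
      near=> z' del => fz't; exfalso.
      have : le (f z') (f z) by near: z'; exact: f_usc.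
      by move/le_leq; rewrite fz't leqNgt ltn_neqAle fzt fzt'.
    have /nbhs_ballP[/= r r0 rP] := f_usc z Kz.
    have r20 : 0 < r / 2 by rewrite divr_gt0.
    near=> z' del => _; right.
    have zz' : ball z (r / 2) z' by near: z'; exact: near_ball.
    have del_r : del <= r / 2 by near: del; exact: nbhs_right_le.
    move=> q z'q; rewrite -fzt; apply: rP; rewrite (splitr r).
    exact: ball_triangle zz' (le_ball del_r z'q).
  move=> KP; near (at_right (0 : R)) => del.
  exists del; first by near: del; exact: nbhs_right_gt.
  by near: del; exact: KP.
(* Two steps of size [e'] must fit within both [e] and [del]. *)
pose e' := Num.min (e / 2) (del / 2).
have e'0 : 0 < e' by rewrite lt_min e20 divr_gt0.
have e'e : e' + e' <= e by rewrite [e]splitr lerD // ge_min lexx.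
have e'e2 : e / 2 + e' <= e by rewrite [leRHS]splitr lerD // ge_min lexx.
have e'del : e' + e' <= del by rewrite [del]splitr lerD // ge_min lexx orbT.
have le_e'e : e' <= e by rewrite (le_trans _ e'e) // lerDl ltW.
pose g' p := if `[< N t.+1 e p >] then g p else t.
have newP p : K p -> N t e' p -> ~ N t.+1 e p ->
    exists z, [/\ K z, f z = t, ball z e' p & forall q, ball z del q -> le (f q) t].
  move=> Kp [z [Kz tfz zp]] nNp; exists z.
  have fzt : f z = t.
    apply/eqP; rewrite eqn_leq tfz andbT leqNgt; apply/negP => tfz'; apply: nNp.
    by exists z; split=> //; exact: le_ball zp.
  split=> //; have [[w [Kw tfw wz]]|//] := delP z Kz fzt.
  case: nNp; exists w; split=> //.
  by apply: le_ball (ball_triangle wz zp).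
exists g', e'; split=> // [p Kp Np|p q Kp Np pq|p q Kp Kq Np Nq pq]; rewrite /g'.
- by case: asboolP => // ?; exact: gm.
- case: asboolP => [oldp|/(newP p Kp Np)[z [Kz _ zp]]].
    by apply: fg => //; exact: le_ball pq.
  by apply; apply: le_ball (ball_triangle zp pq).
(* The new point [q'] is close to some [z] of label [t], hence so is [p'], and the old label of [p']
   bounds [f z]. *)
- have mixed p' q' : K p' -> K q' -> ball p' e' q' -> N t.+1 e p' ->
      N t e' q' -> ~ N t.+1 e q' -> le t (g p').
    move=> Kp' Kq' pq' oldp Nq' /(newP q' Kq' Nq')[z [Kz <- zq _]].
    by apply: fg => //; apply: le_ball (ball_triangle pq' (ball_sym zq)).
  case: asboolP => oldp; case: asboolP => oldq.
  + by apply: gg => //; exact: le_ball pq.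
  + by rewrite (mixed p q) ?orbT.
  + by rewrite (mixed q p) //; exact: ball_sym.
  + by rewrite le_refl.
Unshelve. all: by end_near. Qed.

(** * Finite topological spaces *)

(** Composition with this retraction onto the unit interval extends maps from intervals and cubes to
    the whole line or vector space. *)
Definition clamp (R : realType) (r : R) : R := Num.max 0 (Num.min 1 r).

Lemma clamp_itv (R : realType) (r : R) : clamp r \in `[0, 1]%classic.
Proof.
by rewrite inE /= in_itv /= le_max lexx /= ge_max ler01 ge_min lexx.
Qed.

Lemma clamp_id (R : realType) (r : R) : 0 <= r <= 1 -> clamp r = r.
Proof. by move=> /andP[r0 r1]; rewrite /clamp min_r // max_r. Qed.

Lemma continuous_clamp (R : realType) : continuous (@clamp R).
Proof.
move=> r.
have := @continuous_max R R (fun=> 0) ((fun=> 1) \min id) r.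
apply; first exact: cvg_cst.
by apply: continuous_min; [exact: cvg_cst|exact: cvg_id].
Qed.

Definition clampI (R : realType) (r : R) : unit_interval R := SigSub (clamp_itv r).

Lemma continuous_initial_val (X Y : topologicalType) (A : set Y)
  (f : X -> set_type A) : continuous (set_val \o f) -> continuous f.
Proof.
by move=> cf; apply: continuous_comp_initial.
Qed.

Lemma continuous_clampI (R : realType) : continuous (@clampI R).
Proof. by apply: continuous_initial_val; exact: continuous_clamp. Qed.

Lemma continuous_val (R : realType) : continuous (set_val : unit_interval R -> R).
Proof. exact: initial_continuous. Qed.

Lemma clampI0 (R : realType) (r : R) : r <= 0 -> clampI r = zero.
Proof.
move=> r0; apply/val_inj => /=; rewrite /clamp max_l //.
by rewrite ge_min r0 orbT.
Qed.

Lemma clampI1 (R : realType) (r : R) : 1 <= r -> clampI r = one.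
Proof. by move=> r1; apply/val_inj => /=; rewrite /clamp min_l // max_r. Qed.

(* y lies in all neighbourhoods of x: open sets are down-sets. *)
Definition spec_le (X : topologicalType) (y x : X) : Prop :=
  forall O, open O -> O x -> O y.

Lemma spec_le_refl (X : topologicalType) (x : X) : spec_le x x.
Proof. by []. Qed.

Lemma spec_le_trans (X : topologicalType) (y x z : X) :
  spec_le x y -> spec_le y z -> spec_le x z.
Proof. by move=> xy yz O oO /(yz O oO)/(xy O oO). Qed.

Lemma near_pair1 (S T : topologicalType) (s : S) (t : T) (P : S -> Prop) :
  (\forall s' \near s, P s') -> \forall p \near (s, t), P p.1.
Proof. by move=> sP; exact: (@filter_prod1 _ _ (nbhs s) (nbhs t)). Qed.

Lemma near_pair2 (S T : topologicalType) (s : S) (t : T) (P : T -> Prop) :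
  (\forall t' \near t, P t') -> \forall p \near (s, t), P p.2.
Proof. by move=> tP; exact: (@filter_prod2 _ _ (nbhs s) (nbhs t)). Qed.

Lemma near_neq (R : realType) (t u : unit_interval R) :
  t != u -> \forall t' \near t, t' != u.
Proof.
move=> tu; have vtu : set_val t != set_val u by apply: contra_neq tu => /val_inj.
have nt : nbhs (set_val t : R) [set r | r != set_val u].
  by apply: open_nbhs_nbhs; split; [exact: open_neq|exact: vtu].
have nt' : nbhs t (set_val @^-1` [set r | r != set_val u]) := @continuous_val R t _ nt.
by apply: filterS nt' => t' /=; apply: contra_neq => ->.
Qed.

Lemma continuous_pair (S T U : topologicalType) (f : S -> T) (g : S -> U) :
  continuous f -> continuous g -> continuous (fun s => (f s, g s)).
Proof. by move=> cf cg s; apply: cvg_pair; [exact: cf|exact: cg]. Qed.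

Lemma continuous_compose (S T U : topologicalType) (f : S -> T) (g : T -> U) :
  continuous f -> continuous g -> continuous (fun s => g (f s)).
Proof. by move=> cf cg s; apply: (@cvg_comp _ _ _ f g); [exact: cf|exact: cg]. Qed.

Section FiniteSpace.
Variables (R : realType) (X : topologicalType) (pts : seq X).
Hypothesis ptsP : forall x, x \in pts.

(** Finiteness enters here: for each point [a] not below [x], some open set contains [x] but not
    [a], and the intersection of these finitely many sets is a neighbourhood of [x]. *)
Lemma near_spec_le (x : X) : \forall y \near x, spec_le y x.
Proof.
have near_pts (s : seq X) : \forall y \near x, y \in s -> spec_le y x.
  elim: s => [|a s IHs]; first by near=> y.
  have [ax | /existsNP[U /not_implyP[oU /not_implyP[Ux Ua]]]] := pselect (spec_le a x).
    by near=> y; rewrite inE => /predU1P[-> //|]; near: y.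
  have nU : nbhs x U by exact: open_nbhs_nbhs.
  near=> y; rewrite inE => /predU1P[ya|]; last by near: y.
  by exfalso; apply: Ua; rewrite -ya; near: y.
by apply: filterS (near_pts pts) => y; apply.
Unshelve. all: by end_near. Qed.

Lemma near_continuous (S : topologicalType) (f : S -> X) :
  (forall s, \forall s' \near s, spec_le (f s') (f s)) -> continuous f.
Proof.
move=> nf s U; rewrite nbhsE => -[W [oW Wfs] WU].
by apply: filterS (nf s) => s' /(_ W oW Wfs)/WU.
Qed.

Lemma continuous_near (S : topologicalType) (f : S -> X) :
  continuous f -> forall s, \forall s' \near s, spec_le (f s') (f s).
Proof. by move=> cf s; exact: (cf s _ (near_spec_le (f s))). Qed.

Lemma monotone_continuous (Y : topologicalType) (f : X -> Y) :
  (forall x y, spec_le x y -> spec_le (f x) (f y)) -> continuous f.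
Proof.
move=> fle x U; rewrite nbhsE => -[W [oW Wfs] WU].
by apply: filterS (near_spec_le x) => y /fle /(_ W oW Wfs)/WU.
Qed.

(* The homotopy is constantly f except at one end. *)
Lemma homotopic_spec_le (S : topologicalType) (f g : S -> X) :
  continuous f -> continuous g -> (forall s, spec_le (f s) (g s)) ->
  homotopic R f g /\ homotopic R g f.
Proof.
move=> /continuous_near cf /continuous_near cg fg.
split.
  exists (fun p => if p.2 == one then g p.1 else f p.1); split=> //=; last first.
  - by rewrite eqxx.
  - by move=> s; rewrite (negbTE (@I0_neq_I1 R)).
  apply: near_continuous => -[s t] /=; have nf := near_pair1 t (cf s).
  case: (eqVneq t one) nf => [->|t1] nf.
    apply: (filterS2 _ _ nf (near_pair1 one (cg s))) => -[s' t'] /= f' g'.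
    by case: ifP => // _; exact: spec_le_trans (fg s).
  by apply: (filterS2 _ _ nf (near_pair2 s (near_neq t1))) => -[s' t'] /= ? /negbTE ->.
exists (fun p => if p.2 == zero then g p.1 else f p.1); split=> //=.
- apply: near_continuous => -[s t] /=; have nf := near_pair1 t (cf s).
  case: (eqVneq t zero) nf => [->|t1] nf.
    apply: (filterS2 _ _ nf (near_pair1 zero (cg s))) => -[s' t'] /= f' g'.
    by case: ifP => // _; exact: spec_le_trans (fg s).
  by apply: (filterS2 _ _ nf (near_pair2 s (near_neq t1))) => -[s' t'] /= ? /negbTE ->.
- by rewrite eqxx.
- by move=> s; rewrite eq_sym (negbTE (@I0_neq_I1 R)).
Qed.

Lemma homotopic_trans (S : topologicalType) (f g h : S -> X) :
  homotopic R f g -> homotopic R g h -> homotopic R f h.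
Proof.
move=> [F [cF F0 F1 _]] [G [cG G0 G1 _]].
(* Clamping makes both halves continuous at all times, so only the switch at time 1/2 needs care. *)
pose A (p : S * unit_interval R) := F (p.1, clampI (2 * set_val p.2)).
pose B (p : S * unit_interval R) := G (p.1, clampI (2 * set_val p.2 - 1)).
have cfst : continuous (fun p : S * unit_interval R => p.1) by move=> p; exact: cvg_fst.
have cval : continuous (fun p : S * unit_interval R => 2 * set_val p.2 : R).
  move=> p; apply: cvgM; first exact: cvg_cst.
  apply: (@cvg_comp _ _ _ snd set_val); first exact: cvg_snd.
  exact: continuous_val.
have cpair (r : S * unit_interval R -> R) :
    continuous r -> continuous (fun p : S * unit_interval R => (p.1, clampI (r p))).
  move=> cr; apply: (continuous_pair cfst).
  exact: (continuous_compose cr (@continuous_clampI R)).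
have /continuous_near cA : continuous A.
  exact: (continuous_compose (cpair _ cval) cF).
have /continuous_near cB : continuous B.
  refine (continuous_compose (cpair (fun p => 2 * set_val p.2 - 1) _) cG) => p.
  by apply: cvgB; [exact: cval|exact: cvg_cst].
exists (fun p => if 2 * set_val p.2 <= 1 :> R then A p else B p); split=> //=.
- apply: near_continuous => -[s t] /=.
  have [t1|t1|t1] := ltgtP (2 * set_val t) (1 : R).
  + have : \forall p \near (s, t), 2 * set_val p.2 < 1 :> R.
      have nt : nbhs (2 * set_val t : R) [set r | r < 1].
        by apply: open_nbhs_nbhs; split; [exact: open_lt|exact: t1].
      exact: (cval (s, t) _ nt).
    by move: (cA (s, t)); apply: filterS2 => p pA /ltW ->.
  + have : \forall p \near (s, t), 1 < 2 * set_val p.2 :> R.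
      have nt : nbhs (2 * set_val t : R) [set r | 1 < r].
        by apply: open_nbhs_nbhs; split; [exact: open_gt|exact: t1].
      exact: (cval (s, t) _ nt).
    by move: (cB (s, t)); apply: filterS2 => p pB; rewrite ltNge => /negbTE ->.
  + have AB : A (s, t) = B (s, t).
      by rewrite /A /B /= clampI1 ?t1 // clampI0 ?subrr // F1 G0.
    apply: (filterS2 _ _ (cA (s, t)) (cB (s, t))) => p pA pB.
    by case: ifP => _ //; rewrite AB.
- by move=> s; rewrite mulr0 ler01 /A /= clampI0 ?mulr0 // F0.
- move=> s; rewrite mulr1 (_ : (2 <= 1 :> R) = false) /B /= ?clampI1 ?G1 //.
    by rewrite mulr1 lerBrDr -natr1.
  by apply/negbTE; rewrite -ltNge ltr1n.
Qed.

Lemma homotopic_refl (S : topologicalType) (f : S -> X) :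
  continuous f -> homotopic R f f.
Proof.
move=> cf; exists (fun p => f p.1); split=> //.
by apply: (continuous_compose _ cf) => p; exact: cvg_fst.
Qed.

Definition retracts_onto (e : seq X) (r : X -> X) : Prop :=
  [/\ uniq e, forall x, r x \in e, {in e, forall x, r x = x},
      forall x y, spec_le x y -> spec_le (r x) (r y) & homotopic R r id].

(** Here and in [up_beat_free], [x] and [y] may be equivalent in the preorder; no [z] would then
    exist, so each condition also makes [e] a poset. *)
Definition down_beat_free (e : seq X) : Prop := {in e &, forall x y, x != y ->
  spec_le y x -> exists z, [/\ z \in e, z != x, spec_le z x & ~ spec_le z y]}.

Definition up_beat_free (e : seq X) : Prop := {in e &, forall x y, x != y ->
  spec_le x y -> exists z, [/\ z \in e, z != x, spec_le x z & ~ spec_le y z]}.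

(** Replacing the beat point [x] by [y] is monotone by the beat condition, and the new map is
    pointwise comparable with [r], hence homotopic to it. *)
Lemma retract_beat e r x y : retracts_onto e r -> x \in e -> y \in e -> x != y ->
  (spec_le y x /\ {in e, forall z, z != x -> spec_le z x -> spec_le z y}) \/
  (spec_le x y /\ {in e, forall z, z != x -> spec_le x z -> spec_le y z}) ->
  retracts_onto (rem x e) (fun z => if r z == x then y else r z).
Proof.
move=> [ue re rid rmono rh] xe ye xy beat.
have mono : forall u v, spec_le u v -> spec_le (if r u == x then y else r u)
                                          (if r v == x then y else r v).
  move=> u v /rmono uv; case: (eqVneq (r u) x) uv => [->|ux] uv.
    case: (eqVneq (r v) x) uv => [->|vx] uv //.
    case: beat => -[yx beat]; last exact: beat.
    exact: spec_le_trans uv.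
  case: (eqVneq (r v) x) uv => [->|//] uv.
  case: beat => -[yx beat]; first exact: beat.
  exact: spec_le_trans yx.
split=> //; first by rewrite rem_uniq.
- move=> z; rewrite mem_rem_uniq // !inE.
  by case: (eqVneq (r z) x) => [_|rzx]; rewrite ?re ?rzx // eq_sym xy.
- move=> z; rewrite mem_rem_uniq // !inE => /andP[/negbTE zx ze].
  by rewrite rid // zx.
apply: homotopic_trans rh.
have cr : continuous r := monotone_continuous rmono.
have cr' := monotone_continuous mono.
case: beat => -[yx _].
  by apply: (homotopic_spec_le cr' cr _).1 => z; case: eqP => [->|_] //; exact: spec_le_refl.
by apply: (homotopic_spec_le cr cr' _).2 => z; case: eqP => [->|_] //; exact: spec_le_refl.
Qed.

(** Beat points are removed one at a time; the induction is on the length of the list. *)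
Lemma exists_core : exists e r,
  [/\ retracts_onto e r, down_beat_free e & up_beat_free e].
Proof.
have start : retracts_onto (undup pts) id.
  split=> //; first exact: undup_uniq.
  - by move=> x; rewrite mem_undup.
  - by apply: homotopic_refl => x; exact: cvg_id.
move: {2}(size _) (leqnn (size (undup pts))) => n.
move: (undup pts) (id : X -> X) start => e r; elim: n e r => [|n IHn] e r rete en.
  exists e, r; split=> //; move: en; rewrite leqn0 => /nilP -> x y; by rewrite in_nil.
have [|/not_orP[nd nu]] := pselect
  ((exists x y, [/\ x \in e, y \in e, x != y & (spec_le y x /\
      {in e, forall z, z != x -> spec_le z x -> spec_le z y})]) \/
   (exists x y, [/\ x \in e, y \in e, x != y & (spec_le x y /\
      {in e, forall z, z != x -> spec_le x z -> spec_le y z})])); last first.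
  exists e, r; split=> // x y xe ye xy le_xy; apply: contrapT => nz; [apply: nd|apply: nu];
  exists x, y; split=> //; split=> // z ze zx le_z; apply: contrapT => nle;
  by apply: nz; exists z.
have reduce x y : x \in e -> y \in e -> x != y ->
    (spec_le y x /\ {in e, forall z, z != x -> spec_le z x -> spec_le z y}) \/
    (spec_le x y /\ {in e, forall z, z != x -> spec_le x z -> spec_le y z}) ->
    exists e r, [/\ retracts_onto e r, down_beat_free e & up_beat_free e].
  move=> xe ye xy beat; apply: IHn (retract_beat rete xe ye xy beat) _.
  by rewrite size_rem //; move: en; case: (e) xe.
by move=> [] [x [y [xe ye xy beat]]]; apply: (reduce x y) => //; [left|right].
Qed.

Lemma contractible_retract (a : X) r : retracts_onto [:: a] r -> contractible R X.
Proof.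
move=> [_ ra _ _ rh]; exists (fun=> tt), (fun=> a); split; try exact: cst_continuous.
- rewrite (_ : _ \o _ = r) //; apply/funext => x /=.
  by have := ra x; rewrite inE => /eqP.
- exists (fun=> tt); split=> //; first exact: cst_continuous.
  + by case.
Qed.

End FiniteSpace.

(** * Spheroids from certificates *)

Section Khalimsky.
Variables (R : realType) (k : nat).

(* Khalimsky coordinate of the cell of r when [0, 1] is divided in k edges. *)
Definition khalimsky (r : R) : nat :=
  let t := Num.truncn (k%:R * r) in
  if k%:R * r == t%:R then t.*2 else t.*2.+1.

Lemma khalimsky_even (r : R) t : k%:R * r = t%:R -> khalimsky r = t.*2.
Proof. by move=> e; rewrite /khalimsky e natrK eqxx. Qed.

Lemma khalimsky_odd (r : R) t : t%:R < k%:R * r < t.+1%:R -> khalimsky r = t.*2.+1.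
Proof.
move=> /andP[tr rt]; rewrite /khalimsky.
have -> : Num.truncn (k%:R * r) = t.
  by apply: truncn_def; rewrite ltW //.
by rewrite gt_eqF.
Qed.

Lemma khalimskyP (r : R) : 0 <= r ->
  (exists2 t, k%:R * r = t%:R & khalimsky r = t.*2) \/
  (exists2 t, t%:R < k%:R * r < t.+1%:R & khalimsky r = t.*2.+1).
Proof.
move=> r0; have kr0 : 0 <= k%:R * r by rewrite mulr_ge0.
have /andP[tr rt] := truncn_itv kr0.
have [krt|krt] := eqVneq (k%:R * r) (Num.truncn (k%:R * r))%:R.
  by left; exists (Num.truncn (k%:R * r)) => //; exact: khalimsky_even.
right; exists (Num.truncn (k%:R * r)); last apply: khalimsky_odd.
  by rewrite lt_neqAle eq_sym krt tr.
by rewrite lt_neqAle eq_sym krt tr.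
Qed.

Lemma khalimsky0 : khalimsky 0 = 0%N.
Proof. by rewrite (@khalimsky_even 0 0) // mulr0. Qed.

Lemma khalimsky1 : khalimsky 1 = k.*2.
Proof. by rewrite (@khalimsky_even 1 k) // mulr1. Qed.

Lemma khalimsky_le (r : R) : 0 <= r <= 1 -> (khalimsky r <= k.*2)%N.
Proof.
move=> /andP[r0 r1]; have krk : k%:R * r <= k%:R by rewrite ler_piMr.
have [[t krt ->]|[t /andP[tkr _] ->]] := khalimskyP r0.
  by rewrite leq_double -(ler_nat R) -krt.
by rewrite ltn_double -(ltr_nat R) (lt_le_trans tkr).
Qed.

(** This ties the cells of real points to the combinatorial rounding of grid points. *)
Lemma khalimsky_grid M v : (0 < k)%N -> (0 < M)%N ->
  khalimsky (v%:R / (k * M)%:R) = cell_index M v.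
Proof.
move=> k0 M0; have kR : k%:R != 0 :> R by rewrite pnatr_eq0 -lt0n.
have MR : 0 < M%:R :> R by rewrite ltr0n.
have e : k%:R * (v%:R / (k * M)%:R) = v%:R / M%:R :> R.
  by rewrite natrM invfM mulrCA [k%:R * _]mulrA mulfV // mul1r.
rewrite /cell_index; case: (boolP (M %| v)%N) => [Mv|nMv].
  rewrite addn0; apply: khalimsky_even; rewrite e; apply: (mulIf (lt0r_neq0 MR)).
  by rewrite divfK ?lt0r_neq0 // -natrM divnK.
rewrite addn1; apply: khalimsky_odd; rewrite e ltr_pdivlMr // ltr_pdivrMr // -!natrM !ltr_nat.
rewrite ltn_ceil // andbT ltn_neqAle leq_trunc_div andbT.
by apply: contra nMv => /eqP <-; exact: dvdn_mull.
Qed.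

(** Continuity of the quotient map from the unit interval to the Khalimsky line. *)
Lemma near_khalimsky (r : R) : 0 <= r <= 1 -> \forall r' \near r, 0 <= r' <= 1 ->
  khalimsky r' \in near_range k.*2 (khalimsky r).
Proof.
move=> /andP[r0 r1].
have cont : (fun r : R => k%:R * r) @ r --> k%:R * r.
  by apply: cvgM; [exact: cvg_cst|exact: cvg_id].
have near_lt (a : R) : a < k%:R * r -> \forall r' \near r, a < k%:R * r'.
  move=> akr; have na : nbhs (k%:R * r) [set z | a < z].
    by apply: open_nbhs_nbhs; split; [exact: open_gt|exact: akr].
  exact: (cont _ na).
have near_gt (a : R) : k%:R * r < a -> \forall r' \near r, k%:R * r' < a.
  move=> akr; have na : nbhs (k%:R * r) [set z | z < a].
    by apply: open_nbhs_nbhs; split; [exact: open_lt|exact: akr].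
  exact: (cont _ na).
have [[t krt ->]|[t /andP[tkr krt] ->]] := khalimskyP r0; last first.
  rewrite /near_range /= odd_double /=.
  apply: (filterS2 _ _ (near_lt _ tkr) (near_gt _ krt)) => r' tr' r't _.
  by rewrite inE (@khalimsky_odd r' t) // tr'.
rewrite /near_range odd_double.
have lt1 : t%:R - 1 < k%:R * r by rewrite krt ltrBlDr ltrDl.
have gt1 : k%:R * r < t.+1%:R by rewrite krt ltr_nat.
apply: (filterS2 _ _ (near_lt _ lt1) (near_gt _ gt1)) => r' tr' r't r'01.
rewrite mem_filter khalimsky_le // andTb !inE.
have [r'0 _] := andP r'01.
have [tler'|r'ltt] := leP t%:R (k%:R * r').
  have [tr''|tr''] := eqVneq t%:R (k%:R * r').
    by rewrite (@khalimsky_even r' t) ?eqxx ?orbT.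
  rewrite (@khalimsky_odd r' t) ?eqxx ?orbT //.
  by rewrite lt_neqAle tr'' tler' r't.
case: t krt lt1 gt1 tr' r't r'ltt => [|t] krt lt1 gt1 tr' r't r'ltt.
  by have := mulr_ge0 (ler0n R k) r'0; rewrite leNgt r'ltt.
rewrite (@khalimsky_odd r' t) ?eqxx //.
by rewrite r'ltt andbT -[t%:R](addrK 1) natr1.
Qed.

End Khalimsky.

Section Vectors.
Variables (R : realType) (n : nat).

Lemma near_rV (Q : 'I_n -> R -> Prop) (v : 'rV[R]_n) :
  (forall i, \forall r \near v ord0 i, Q i r) ->
  \forall w \near v, forall i, Q i ((w : 'rV[R]_n) ord0 i).
Proof.
move=> nQ; exists (fun _ i => [set r | Q i r]) => [i j|w QW i].
  by rewrite ord1; exact: nQ.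
exact: QW.
Qed.

Lemma clamp_cube (v : 'rV[R]_n) : map_mx (@clamp R) v \in cube R n.
Proof.
by rewrite inE => i; rewrite mxE; have := clamp_itv (v ord0 i); rewrite inE /= in_itv.
Qed.

Definition clampV (v : 'rV[R]_n) : set_type (cube R n) := SigSub (clamp_cube v).

Lemma continuous_clampV : continuous clampV.
Proof.
apply: continuous_initial_val => v U [P nP PU].
exists (fun i j => @clamp R @^-1` P i j) => [i j|w Pw].
  have := nP i j; rewrite mxE; exact: continuous_clamp.
by apply: PU => i j; rewrite mxE; exact: Pw.
Qed.

Lemma cube_bounds (c : set_type (cube R n)) i : 0 <= (set_val c : 'rV[R]_n) ord0 i <= 1.
Proof. exact: (set_valP c). Qed.

Definition cell (k : nat) (v : 'rV[R]_n) : gpoint :=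
  fun d => if insub d is Some i then khalimsky k (v ord0 i) else 0%N.

Lemma cellE k v (i : 'I_n) : cell k v i = khalimsky k (v ord0 i).
Proof. by rewrite /cell valK. Qed.

Lemma cell_out k v d : (n <= d)%N -> cell k v d = 0%N.
Proof. by move=> nd; rewrite /cell insubN // -leqNgt. Qed.

End Vectors.

(** * Maps from cubes to a space that retracts onto a finite poset *)

Section Sphere.
Variables (R : realType) (X : topologicalType) (pts : seq X).
Hypothesis ptsP : forall x, x \in pts.
Variables (s : poset) (pt : nat -> X) (lab : X -> nat).
Hypotheses (lab_lt : forall x, (lab x < size s)%N)
  (lab_mono : forall x y, spec_le x y -> ple s (lab x) (lab y))
  (pt_mono : forall i j, (i < size s)%N -> (j < size s)%N ->
     ple s i j -> spec_le (pt i) (pt j))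
  (ptK : forall i, (i < size s)%N -> lab (pt i) = i)
  (ple_leq : forall i j, ple s i j -> (i <= j)%N).

Section Spherical.
Variables (n : nat) (col : nat -> nat) (k x : nat) (l : gpoint -> nat).
Hypothesis sph : spherical s n col k x l.

Let K := k.*2.

Let n_gt0 : (0 < n)%N. Proof. by case/and5P: sph. Qed.
Let k_gt0 : (0 < k)%N. Proof. by case/and5P: sph. Qed.
Let x_lt : (x < size s)%N. Proof. by case/and5P: sph. Qed.

Let in_grid (p : gpoint) := forall d, if (d < n)%N then (p d <= K)%N else p d == 0%N.

Let mem_range m (p : gpoint) d :
  (forall d, if (d < n)%N then (p d < m)%N else p d == 0%N) ->
  if d \in iota 0 n then p d \in iota 0 m else p d == origin d.
Proof. by move=> /(_ d); rewrite !mem_iota !leq0n !add0n. Qed.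

Let l_lt p : in_grid p -> (l p < size s)%N.
Proof.
move=> gp; case/and5P: sph => _ _ _ /= + _ => /(@all_grid _ _ _ _ p) lp.
have /andP[] // : (l p < size s)%N &&
    (has (fun d => (p d == 0%N) || (p d == K)) (iota 0 n) ==> (l p == x)).
by apply: lp => d; exact: (@mem_range K.+1 p d gp).
Qed.

Let l_boundary p d : in_grid p -> (d < n)%N -> p d = 0%N \/ p d = K -> l p = x.
Proof.
move=> gp dn pd; case/and5P: sph => _ _ _ /= + _ => /(@all_grid _ _ _ _ p) lp.
have /andP[_ /implyP lx] : (l p < size s)%N &&
    (has (fun d => (p d == 0%N) || (p d == K)) (iota 0 n) ==> (l p == x)).
  by apply: lp => e; exact: (@mem_range K.+1 p e gp).
apply/eqP/lx/hasP; exists d; first by rewrite mem_iota.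
by case: pd => ->; rewrite eqxx ?orbT.
Qed.

Let l_mono p q : in_grid p ->
  (forall d, if (d < n)%N then q d \in near_range K (p d) else q d == 0%N) ->
  ple s (l q) (l p).
Proof.
move=> gp pq; case/and5P: sph => _ _ _ _ /and4P[/= + _ _ _] => /(@all_grid _ _ _ _ p) lp.
have /(@all_grid _ _ _ _ q) : all (fun q => ple s (l q) (l p))
    (grid (fun d => near_range K (p d)) (iota 0 n) origin).
  by apply: lp => d; exact: (@mem_range K.+1 p d gp).
by apply=> d; have := pq d; rewrite mem_iota /= add0n.
Qed.

Let l_chain b p q : (forall d, if (d < n)%N then (b d < K)%N else b d == 0%N) ->
  in_unit_box n b p -> in_unit_box n b q -> pcmp s (l p) (l q).
Proof.
move=> gb bp bq; case/and5P: sph => _ _ _ _ /and4P[_ /= + _ _] => /(@all_grid _ _ _ _ b) lb.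
set c := map l (grid (fun d => [:: b d; (b d).+1]) (iota 0 n) origin).
have /allP cc : all (fun a => all (pcmp s a) c) c.
  by apply: lb => d; exact: (@mem_range K b d gb).
have lc r : in_unit_box n b r -> l r \in c.
  move=> br; apply: map_grid => d; have := br d; rewrite mem_iota /= add0n !inE.
  by case: ifP => _ => [[]|] ->; rewrite eqxx ?orbT.
by have /allP := cc _ (lc p bp); apply; exact: lc.
Qed.

Definition realization (c : set_type (cube R n)) : X := pt (l (cell k (set_val c))).

Let cell_grid (c : set_type (cube R n)) : in_grid (cell k (set_val c)).
Proof.
move=> d; case: ifP => dn.
  by rewrite -[d]/(val (Ordinal dn)) cellE khalimsky_le // cube_bounds.
by rewrite cell_out // leqNgt dn.
Qed.

Lemma realization_continuous : continuous realization.
Proof.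
apply: near_continuous => c.
have nc : \forall w \near (set_val c : 'rV[R]_n), forall i, 0 <= (w : 'rV[R]_n) ord0 i <= 1 ->
    khalimsky k (w ord0 i) \in near_range K (khalimsky k ((set_val c : 'rV[R]_n) ord0 i)).
  apply: (near_rV (Q := fun i r => 0 <= r <= 1 ->
    khalimsky k r \in near_range K (khalimsky k ((set_val c : 'rV[R]_n) ord0 i)))) => i.
  by apply: near_khalimsky; exact: cube_bounds.
have nc' : nbhs c (set_val @^-1` [set w : 'rV[R]_n | forall i, 0 <= (w : 'rV[R]_n) ord0 i <= 1 ->
    khalimsky k (w ord0 i) \in near_range K (khalimsky k ((set_val c : 'rV[R]_n) ord0 i))]).
  exact: (@initial_continuous _ _ (set_val : set_type (cube R n) -> 'rV[R]_n) c _ nc).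
apply: filterS nc' => c' cc'; apply: pt_mono; [exact/l_lt/cell_grid..|].
apply: l_mono; first exact: cell_grid.
move=> d; case: ifP => dn; last by rewrite cell_out // leqNgt dn.
by rewrite -[d]/(val (Ordinal dn)) !cellE; apply: cc'; exact: cube_bounds.
Qed.

Lemma realization_spheroid : spheroid (pt x) realization.
Proof.
split; first exact: realization_continuous.
move=> c [i ci]; rewrite /realization (@l_boundary _ i) //.
by rewrite cellE; case: ci => ->; [left; exact: khalimsky0|right; exact: khalimsky1].
Qed.

(** The class of [realization] equals that of the constant map, which contains the constant map
    itself. *)
Lemma realization_homotopic : trivial_homotopy_group R n (pt x) ->
  homotopic_rel R (@cube_boundary R n) realization (cst (pt x)).
Proof.
move=> triv; have rel_refl (f : set_type (cube R n) -> X) : continuous f ->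
    homotopic_rel R (@cube_boundary R n) f f.
  move=> cf; exists (fun p => f p.1); split=> //.
  by apply: (continuous_compose _ cf) => p; exact: cvg_fst.
have : homotopy_group R n (pt x) (spheroid_class (pt x) realization).
  by exists realization => //; exact: realization_spheroid.
rewrite triv => /= rc.
have : @spheroid_class R X n (pt x) (cst (pt x)) (cst (pt x)).
  split; last by apply: rel_refl; exact: cst_continuous.
  by split=> //; exact: cst_continuous.
by rewrite -rc => -[].
Qed.

Let cell_index_lt M v : (1 < M)%N -> (v < k * M)%N -> (cell_index M v < K)%N.
Proof.
move=> M1 vk; have M0 := ltnW M1.
have vM : (v %/ M < k)%N by rewrite ltn_divLR.
by rewrite /cell_index /K; case: (M %| v)%N; lia.
Qed.

(** The labels of a null-homotopy, discretized on a fine grid, would give a filling excluded by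
    [spherical_not_filled]. *)
Theorem spherical_homotopy_group : ~ trivial_homotopy_group R n (pt x).
Proof.
move=> /realization_homotopic[H [cH H0 H1 Hbd]].
pose F (z : 'rV[R]_n * R) := lab (H (clampV z.1, clampI z.2)).
have cF z : \forall w \near z, ple s (F w) (F z).
  have cHc : continuous (fun z : 'rV[R]_n * R => H (clampV z.1, clampI z.2)).
    apply: (continuous_compose _ cH); apply: continuous_pair.
      apply: (continuous_compose _ (@continuous_clampV R n)) => p; exact: cvg_fst.
    apply: (continuous_compose _ (@continuous_clampI R)) => p; exact: cvg_snd.
  by apply: filterS (continuous_near ptsP cHc z) => w; exact: lab_mono.
pose C : set ('rV[R]_n * R) := cube R n `*` `[0, 1].
have cC : compact C.
  apply: compact_setX; last exact: segment_compact.
  have := @rV_compact R n (fun=> `[0, 1]%classic) (fun=> @segment_compact R 0 1).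
  by congr compact; apply/seteqP; split=> v /= v01 i; have := v01 i; rewrite /= in_itv.
have le_refl : reflexive (ple s) by move=> i; rewrite /ple eqxx.
have F_lt z : (F z < size s)%N := lab_lt _.
have [g [e [e0 g_lt Fg gg]]] :=
  discretization cC le_refl ple_leq F_lt (fun z _ => cF z).
(* This makes [M] at least 2, as required by [cell_indexS], and the mesh [1 / N] smaller than
   [e]. *)
pose M := (Num.truncn e^-1).+2; pose N := (k * M)%N.
have M1 : (1 < M)%N by [].
have N1 : (1 < N)%N by rewrite (leq_trans M1) // leq_pmull.
have N0 : (0 < N)%N := ltnW N1.
have Ne : N%:R^-1 < e.
  rewrite invf_plt ?posrE ?ltr0n //; apply: lt_le_trans (truncnS_gt _) _.
  by rewrite ler_nat (leq_trans (leqnSn _)) // leq_pmull.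
pose G (p : gpoint) : 'rV[R]_n * R := (\row_i ((p i)%:R / N%:R), (p n)%:R / N%:R).
have frac (v : nat) : (v <= N)%N -> 0 <= (v%:R / N%:R : R) <= 1.
  by move=> vN; rewrite divr_ge0 //= ler_pdivrMr ?ltr0n // mul1r ler_nat.
have GC p : (forall d, (d <= n)%N -> (p d <= N)%N) -> C (G p).
  move=> pN; split=> /= [i|]; first by rewrite mxE frac // pN // ltnW.
  by rewrite /= in_itv /= frac // pN.
have clampG p : (forall d, (d <= n)%N -> (p d <= N)%N) ->
    set_val (clampV (G p).1) = \row_i ((p i)%:R / N%:R) :> 'rV[R]_n.
  move=> pN; apply/rowP => i; rewrite !mxE clamp_id // frac // pN //; exact: ltnW.
have Fbot p : (forall d, (d <= n)%N -> (p d <= N)%N) -> p n = 0%N ->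
    (forall d, (n < d)%N -> p d = 0%N) -> F (G p) = l (cell_index M \o p).
  move=> pN pn0 pout; rewrite /F /= pn0 mul0r clampI0 // H0 /realization ptK.
    congr l; apply/funext => d /=; have [dn|nd] := ltnP d n.
      by rewrite -[d]/(val (Ordinal dn)) cellE clampG // mxE khalimsky_grid.
    rewrite cell_out // (_ : p d = 0%N) ?cell_index0 //.
    by move: nd; rewrite leq_eqVlt => /predU1P[<-|/pout].
  exact/l_lt/cell_grid.
have Fbdry p : (forall d, (d <= n)%N -> (p d <= N)%N) ->
    p n = N \/ (exists2 d, (d < n)%N & p d = 0%N \/ p d = N) -> F (G p) = x.
  move=> pN [pnN|[d dn pd]].
    by rewrite /F /= pnN divff ?pnatr_eq0 -?lt0n // clampI1 // H1 ptK.
  have bd : cube_boundary (clampV (G p).1).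
    exists (Ordinal dn); rewrite clampG // mxE.
    by case: pd => ->; [left; rewrite mul0r|right; rewrite divff // pnatr_eq0 -lt0n].
  by rewrite /F Hbd // (realization_spheroid).2 // ptK.
pose bdry (p : gpoint) := has (fun d => (p d == 0%N) || (p d == N)) (iota 0 n.+1).
(* The boundary keeps its exact labels. Against an interior point they are comparable because [g]
   bounds [F] nearby; between two boundary points the certificate is used. *)
pose L p := if bdry p then F (G p) else g (G p).
apply: (@spherical_not_filled s n col k x l M L sph M1).
- move=> p pN; rewrite /L; case: ifP => _; first exact: lab_lt.
  by apply: g_lt; apply: GC => d dn; have := pN d; rewrite dn.
- move=> b p q bN bp bq.
  have box_le r : in_unit_box n.+1 b r -> forall d, (d <= n)%N -> (r d <= N)%N.
    move=> br d dn; have := br d; rewrite ltnS dn => -[] ->; last exact: bN.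
    exact: ltnW (bN d dn).
  have pN := box_le p bp; have qN := box_le q bq.
  have close r r' : in_unit_box n.+1 b r -> in_unit_box n.+1 b r' -> ball (G r) e (G r').
    move=> br br'.
    have rr' d : (d <= n)%N -> ball ((r d)%:R / N%:R : R) e ((r' d)%:R / N%:R).
      move=> dn; rewrite /ball /= -mulrBl normrM normfV normr_nat.
      apply: le_lt_trans Ne; rewrite ler_piMl ?invr_ge0 //.
      have := br d; have := br' d; rewrite ltnS dn.
      by move=> [->|->] [->|->]; rewrite ?subrr ?normr0 ?ler01 // -?natr1 ?opprD ?addrA
        ?addrK ?subrr ?sub0r ?normrN ?normr1 // addrAC subrr add0r normr1.
    split; last exact: rr'.
    by split=> // i j; rewrite !mxE; apply: rr'; exact: ltnW.
  have sides r : in_unit_box n.+1 b r -> bdry r ->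
      r n <> 0%N -> F (G r) = x.
    move=> br /hasP[d]; rewrite mem_iota ltnS => /andP[_ dn] rd rn; apply: Fbdry.
      exact: box_le.
    move: dn; rewrite leq_eqVlt => /predU1P[dn|dn].
      by left; move: rd; rewrite dn => /orP[/eqP//|/eqP].
    by right; exists d => //; case/orP: rd => /eqP; [left|right].
  have bot r : in_unit_box n.+1 b r -> r n = 0%N -> F (G r) = l (cell_index M \o r).
    move=> br rn; apply: Fbot => // [|d nd]; first exact: box_le.
    by have := br d; rewrite ltnS leqNgt nd.
  have chain r r' : in_unit_box n.+1 b r -> in_unit_box n.+1 b r' ->
      r n = 0%N -> r' n = 0%N -> pcmp s (l (cell_index M \o r)) (l (cell_index M \o r')).
    move=> br br' rn r'n.
    have inbox t : in_unit_box n.+1 b t -> t n = 0%N ->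
        in_unit_box n (fun d => if (d < n)%N then cell_index M (b d) else 0%N) (cell_index M \o t).
      move=> bt tn d; have := bt d; rewrite ltnS /=.
      case: (ltngtP d n) => [dn|nd td|->]; rewrite ?td ?tn ?cell_index0 // => td.
      by case: td => ->; [left|exact: cell_indexS].
    apply: (@l_chain (fun d => if (d < n)%N then cell_index M (b d) else 0%N)); try exact: inbox.
    move=> d /=; case: (ltnP d n) => // dn.
    by apply: cell_index_lt => //; apply: bN; exact: ltnW.
  (* Since [r'] is at height 1 and [1 < N], it lies on a lateral face. Its projection to the bottom
     also has label [x], which reduces the claim to [chain]. *)
  have mixed r r' : in_unit_box n.+1 b r -> in_unit_box n.+1 b r' -> bdry r' ->
      r n = 0%N -> r' n <> 0%N -> pcmp s (F (G r)) (F (G r')).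
    move=> br br' bdr' rn r'n; rewrite (sides r') // bot //.
    have bn : b n = 0%N by have := br n; rewrite ltnSn rn => -[].
    have [d dn r'd] : exists2 d, (d < n)%N & r' d = 0%N \/ r' d = N.
      have /hasP[d] := bdr'; rewrite mem_iota ltnS => /andP[_ dn] r'd; exists d; last first.
        by case/orP: r'd => /eqP; [left|right].
      rewrite ltn_neqAle dn andbT; apply/eqP => {}dn; move: r'd; rewrite dn.
      have := br' n; rewrite ltnSn bn => -[//|->]; rewrite orFb => /eqP N1'.
      by rewrite -N1' in N1.
    have br'' : in_unit_box n.+1 b (update r' n 0).
      move=> f; have := br' f; rewrite /update; case: eqP => // -> _.
      by rewrite ltnSn bn; left.
    rewrite -(@l_boundary (cell_index M \o update r' n 0) d) //.
    + by apply: chain => //; rewrite /update eqxx.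
    + move=> f; have := br'' f; rewrite /= ltnS.
      case: ltngtP => [fn|fn|->]; last by rewrite /update eqxx cell_index0.
        move=> _; rewrite -[K](cell_index_mul k (ltnW M1)); apply: cell_index_le => //.
        by apply: (box_le _ br''); exact: ltnW.
      by move=> ->; rewrite cell_index0.
    + rewrite /= /update ltn_eqF //; case: r'd => ->; first by left; exact: cell_index0.
      by right; exact: cell_index_mul (ltnW M1).
  rewrite /L; case: (boolP (bdry p)) => bdp; case: (boolP (bdry q)) => bdq.
  + have [pn|/eqP pn] := eqVneq (p n) 0%N; have [qn|/eqP qn] := eqVneq (q n) 0%N.
    * by rewrite !bot //; exact: chain.
    * exact: mixed.
    * by rewrite pcmp_sym; exact: mixed.
    * by rewrite !sides // pcmp_refl.
  + by rewrite /pcmp Fg //; [exact: GC|exact: close].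
  + by rewrite /pcmp orbC Fg //; [exact: GC|exact: close].
  + by apply: gg; [exact: GC..|exact: close].
- move=> p pN.
  have pn : p n = 0%N by have := pN n; rewrite ltnn => /eqP.
  have pN' d : (d <= n)%N -> (p d <= N)%N.
    by rewrite leq_eqVlt => /predU1P[->|dn]; [rewrite pn|have := pN d; rewrite dn].
  rewrite /L ifT; last by apply/hasP; exists n; rewrite ?mem_iota ?ltnS ?leqnn // pn.
  by apply: Fbot => // d nd; have := pN d; rewrite ltnNge (ltnW nd) => /eqP.
- move=> p pN pbd.
  have pN' d : (d <= n)%N -> (p d <= N)%N by move=> dn; have := pN d; rewrite dn.
  rewrite /L ifT; first exact: Fbdry.
  case: pbd => [pn|[d dn pd]]; apply/hasP.
    by exists n; rewrite ?mem_iota ?ltnS ?leqnn // pn eqxx orbT.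
  by exists d; [rewrite mem_iota add0n ltnS (ltnW dn)|apply/orP; case: pd => /eqP; [left|right]].
Qed.

End Spherical.
(** Membership in [A] is locally constant along a path, so it is constant because the line is
    connected. *)
Theorem disconnected_path_connected A : disconnected s A -> ~ path_connected R X.
Proof.
move=> /and3P[/allP Aconst /hasP[a + Aa] /hasP[b + Ab]].
rewrite !mem_iota !add0n /= => a_s b_s /(_ (pt a) (pt b))[gam].
pose phi (t : R) := A (lab (gam (clampI t))).
have cgam : continuous (fun t : R => gam (clampI t)).
  by apply: (continuous_compose (@continuous_clampI R)) => t; exact: cts_fun.
have phi_near t : \forall t' \near t, phi t' = phi t.
  apply: filterS (continuous_near ptsP cgam t) => t' /lab_mono tt'.
  have := Aconst (lab (gam (clampI t'))); rewrite mem_iota lab_lt => /(_ isT)/allP.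
  move=> /(_ (lab (gam (clampI t)))); rewrite mem_iota lab_lt => /(_ isT).
  by rewrite /pcmp tt' => /eqP.
have phi0 : phi 0 by rewrite /phi clampI0 // path_zero ptK.
have phi1 : ~~ phi 1 by rewrite /phi clampI1 // path_one ptK.
have oP (P : bool -> Prop) : open [set t | P (phi t)].
  by rewrite openE => t /= Pt; apply: filterS (phi_near t) => t' /= ->.
have cR : connected [set: R] by apply/connected_intervalP.
have phiT : [set t | phi t] = [set: R].
  apply: cR; first by exists 0.
    by exists [set t | phi t]; rewrite ?setTI //; exact: (oP (fun b => b)).
  exists [set t | phi t]; rewrite ?setTI //; rewrite -openC.
  by rewrite (_ : ~` _ = [set t | ~ phi t]) //; exact: (oP (fun b => ~ b)).
by move: phi1; have : [set: R] 1 by []; rewrite -phiT /= => ->.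
Qed.

End Sphere.

(** * Enumeration of the cores *)

Local Close Scope ring_scope.
Local Open Scope card_scope.

Lemma explore_cores : explore 8 [::].
Proof. by vm_cast_no_check (erefl true). Qed.

Lemma mem_bitlists (b : seq bool) : b \in bitlists (size b).
Proof.
elim: b => //= -[] b IHb; rewrite mem_cat; apply/orP; [left|right]; exact: map_f.
Qed.

(** The induction follows the branch of the search given by the initial segments of [s]. *)
Lemma exploreP fuel s0 s : explore fuel s0 -> take (size s0) s = s0 ->
  size s0 <= size s <= size s0 + fuel ->
  (forall k, size s0 <= k < size s ->
     size (nth [::] s k) = k /\ extends (take k s) (nth [::] s k)) ->
  settled s.
Proof.
elim: fuel s0 => [|fuel IHfuel] s0 /=; case: ifP => // s0_ok.
  by rewrite addn0 => _ s0s /anti_leq ss _; move: s0_ok; rewrite -s0s ss take_size.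
move=> /allP ex s0s /andP[s0_le s_le] sP.
have [ss|s0_lt] := eqVneq (size s0) (size s).
  by move: s0_ok; rewrite -s0s ss take_size.
have {}s0_lt : size s0 < size s by rewrite ltn_neqAle s0_lt.
have [|sk ext] := sP (size s0); first by rewrite leqnn.
have := ex (nth [::] s (size s0)); rewrite -{2}sk mem_bitlists => /(_ isT).
rewrite s0s in ext; rewrite ext => /IHfuel; apply; rewrite ?size_rcons.
- by rewrite (take_nth [::]) // s0s.
- by rewrite s0_lt addSnnS.
- by move=> k /andP[k1 k2]; apply: sP; rewrite (ltnW k1).
Qed.

Lemma non_trivialP s : non_trivial s ->
  (exists A, disconnected s A) \/
  (exists n col k x l, spherical s n col k x l).
Proof.
rewrite /non_trivial; case: ifP => [dis _|_]; first by left; eexists; exact: dis.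
case: ifP => [circ _|_].
  right; move: circ; rewrite /find_circle; case: (loops s (iota 0 (size s))) => // -[[m U] c] _ sph.
  by do 5 eexists; exact: sph.
case: ifP => [sph2 _|_ sph3]; last by right; do 5 eexists; exact: sph3.
right; move: sph2 => /hasP[u _].
case: [seq v <- _ | _] => // v [] //=.
case: (loops s [seq y <- iota 0 (size s) | (y != u) && (y != v)]) => //.
move=> -[[m U] c] _ sph.
by do 5 eexists; exact: sph.
Qed.

(** Distinct points are picked one by one: either the list exhausts [X] with at most [m] points, or
    [m + 1] are found and embed ['I_m.+1]. *)
Lemma few_points (X : choiceType) m : ~ ([set: 'I_m.+1] #<= [set: X]) ->
  exists pts : seq X, (forall x, x \in pts) /\ size pts <= m.
Proof.
move=> nle; have grow j : j <= m.+1 -> (exists2 s : seq X, uniq s & size s = j) \/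
    (exists pts : seq X, (forall x, x \in pts) /\ size pts <= m).
  elim: j => [|j IHj] jm; first by left; exists [::].
  have [[s us sj]|] := IHj (ltnW jm); last by right.
  have [[x xs]|/forallNP all_s] := pselect (exists x, x \notin s).
    by left; exists (x :: s); rewrite /= ?xs ?us ?sj.
  by right; exists s; split=> [x|]; [have /negP := all_s x; rewrite negbK|rewrite sj].
have [[s us sm]|//] := grow m.+1 (leqnn _).
exfalso; apply: nle; case: s us sm => // x0 s us sm.
pose f (i : 'I_m.+1) := nth x0 (x0 :: s) i.
have f_inj : {in [set: 'I_m.+1] &, injective f}.
  by move=> i j _ _ /eqP; rewrite nth_uniq ?sm // => /eqP; exact: val_inj.
rewrite -(card_le_eql (inj_card_eq f_inj)); exact: subset_card_le.
Qed.

(** * Encoding a core as a poset met by the search *)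

Section Core.
Variables (R : realType) (X : topologicalType) (pts : seq X).
Hypothesis ptsP : forall x, x \in pts.
Variables (e : seq X) (r : X -> X) (x0 : X).
Hypotheses (rete : retracts_onto R e r) (downe : down_beat_free e)
  (upe : up_beat_free e).

(** Sorting by this number yields a linear extension of the order, and one that meets the first
    condition of [extends]. *)
Let below x := count (fun y => `[< spec_le y x >]) e.
Let es := sort (fun x y => below x <= below y) e.
Let m := size es.
Let pt := nth x0 es.
Let lab x := index (r x) es.
Let row k := mkseq (fun j => `[< spec_le (pt j) (pt k) >]) k.
Let s : poset := mkseq row m.

Let mem_es x : (x \in es) = (x \in e). Proof. by rewrite mem_sort. Qed.
Let ues : uniq es. Proof. by rewrite sort_uniq; case: rete. Qed.
Let size_s : size s = m. Proof. by rewrite size_mkseq. Qed.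
Let pt_e i : i < m -> pt i \in e. Proof. by rewrite -mem_es; exact: mem_nth. Qed.

Let spec_le_anti : {in e &, forall x y, spec_le x y -> spec_le y x -> x = y}.
Proof.
move=> x y xe ye xy yx; apply/eqP; apply: contrapT => /negP nxy.
have [z [_ _ xz nyz]] := upe xe ye nxy xy; apply: nyz; exact: spec_le_trans xz.
Qed.

Let spec_lexx (x : X) : `[< spec_le x x >]. Proof. exact/asboolP. Qed.

Let below_lt : {in e &, forall x y, spec_le x y -> x != y -> below x < below y}.
Proof.
move=> x y xe ye xy nxy; rewrite /below !(permP (perm_to_rem ye)) /=.
rewrite spec_lexx (_ : `[< spec_le y x >] = false); last first.
  by apply/asboolP => yx; move/eqP: nxy; apply; exact: spec_le_anti.
rewrite add0n add1n ltnS; apply: sub_count => z /asboolP zx; apply/asboolP.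
exact: spec_le_trans xy.
Qed.

Let below_sorted i j : i <= j -> j < m -> below (pt i) <= below (pt j).
Proof.
move=> ij jm; have tot : total (fun x y => below x <= below y).
  by move=> x y; exact: leq_total.
have := sorted_leq_nth (fun y x z => @leq_trans (below y) (below x) (below z))
  (fun x => leqnn (below x)) x0 (sort_sorted tot e).
by apply => //; rewrite inE //; exact: leq_ltn_trans jm.
Qed.

Let pt_inj i j : i < m -> j < m -> pt i = pt j -> i = j.
Proof. by move=> im jm /eqP; rewrite nth_uniq // => /eqP. Qed.

Let spec_le_leq i j : i < m -> j < m -> spec_le (pt i) (pt j) -> i <= j.
Proof.
move=> im jm ij; rewrite leqNgt; apply/negP => ji.
have := below_sorted (ltnW ji) im; rewrite leqNgt below_lt ?pt_e //.
by apply: contraTneq ji => /(pt_inj im jm) ->; rewrite ltnn.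
Qed.

Let pleE i j : i < m -> j < m -> ple s i j = `[< spec_le (pt i) (pt j) >].
Proof.
move=> im jm; rewrite /ple nth_mkseq // /row.
have [->|ij] := eqVneq i j; first by rewrite spec_lexx.
have [lt_ij|le_ji] := ltnP i j; first by rewrite nth_mkseq.
rewrite nth_default ?size_mkseq //; apply/esym/asboolP => /(spec_le_leq im jm).
by rewrite leqNgt ltn_neqAle eq_sym ij le_ji.
Qed.

Let ple_leq i j : ple s i j -> i <= j.
Proof.
move=> /predU1P[->//|]; have [jm|mj] := ltnP j m; last first.
  by rewrite [nth [::] s j]nth_default ?size_s // nth_nil.
rewrite nth_mkseq //; have [/ltnW //|ji] := ltnP i j.
by rewrite nth_default // size_mkseq.
Qed.

Let lab_lt x : lab x < size s.
Proof. by rewrite size_s index_mem mem_es; case: rete. Qed.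

Let ptlab x : pt (lab x) = r x.
Proof. by rewrite /pt nth_index // mem_es; case: rete. Qed.

Let ptK i : i < size s -> lab (pt i) = i.
Proof.
rewrite size_s => im; have re : r (pt i) = pt i by case: rete => _ _ + _ _; apply; exact: pt_e.
by rewrite /lab re index_uniq.
Qed.

Let lab_mono x y : spec_le x y -> ple s (lab x) (lab y).
Proof.
move=> xy; rewrite pleE -?size_s // !ptlab; apply/asboolP.
by case: rete => _ _ _ + _; apply.
Qed.

Let pt_mono i j : i < size s -> j < size s -> ple s i j -> spec_le (pt i) (pt j).
Proof. by rewrite size_s => im jm; rewrite pleE // => /asboolP. Qed.

(** The successor counts the point itself; points with larger index are never below it. *)
Let belowE k : k < m -> below (pt k) = (count id (row k)).+1.
Proof.
move=> km; have -> : below (pt k) = count (fun y => `[< spec_le y (pt k) >]) es.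
  by apply/esym/permP; rewrite perm_sort.
rewrite -(mkseq_nth x0 es) -/pt -/m /row /mkseq !count_map.
rewrite -(subnKC km) -addn1 -addnA iotaD count_cat add0n add1n /=.
rewrite spec_lexx.
rewrite [X in _ + (_ + X)](_ : _ = 0) ?addn0 ?addn1 //.
apply/eqP; rewrite -leqn0 leqNgt -has_count; apply/hasPn => j.
rewrite mem_iota => /andP[kj jm] /=; apply/asboolP => jk.
have {}jm : j < m by rewrite -(subnKC km).
by have := spec_le_leq jm km jk; rewrite leqNgt kj.
Qed.

Let extends_row k : k < m -> extends (take k s) (row k).
Proof.
move=> km; have skt : size (take k s) = k by rewrite size_takel // size_s ltnW.
have nth_t i : i < k -> nth [::] (take k s) i = row i.
  by move=> ik; rewrite nth_take // nth_mkseq // (ltn_trans ik).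
have nth_r i j : i < j -> j < m -> nth false (row j) i = `[< spec_le (pt i) (pt j) >].
  by move=> ij jm; rewrite nth_mkseq.
have ple_t i j : i < k -> j < k -> ple (take k s) i j = ple s i j.
  move=> ik jk; rewrite /ple nth_t // [nth [::] s j]nth_mkseq //; exact: ltn_trans km.
rewrite /extends skt; apply/and3P; split.
- rewrite -nth_last skt; case: k km {skt nth_t ple_t} => [|k] km; first by rewrite take0.
  rewrite nth_take // nth_mkseq ?(ltnW km) //=.
  by have := below_sorted (leqnSn k) km; rewrite !belowE ?(ltnW km).
- apply/allP => i; rewrite mem_iota => /andP[_ ik]; apply/implyP.
  rewrite nth_r // => /asboolP ile; apply/allP => j; rewrite mem_iota => /andP[_ jk].
  rewrite nth_t //; have im := ltn_trans ik km; have jm := ltn_trans jk km.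
  have [ji|ij] := ltnP j i; last by rewrite nth_default ?size_mkseq.
  rewrite !nth_r //; apply/implyP => /asboolP jle; apply/asboolP.
  exact: spec_le_trans ile.
- apply/allP => i; rewrite mem_iota => /andP[_ ik]; apply/implyP.
  have im := ltn_trans ik km; rewrite nth_r // => /asboolP ile.
  have nki : pt k != pt i.
    by apply: contraTneq ik => /(pt_inj km im) ->; rewrite ltnn.
  have [z [ze zk zle nzle]] := downe (pt_e km) (pt_e im) nki ile.
  have zm : index z es < m by rewrite index_mem mem_es.
  have ptz : pt (index z es) = z by rewrite /pt nth_index // mem_es.
  have zlk : index z es < k.
    rewrite ltn_neqAle spec_le_leq ?ptz // andbT.
    by apply: contraNneq zk => <-; rewrite ptz.
  apply/hasP; exists (index z es); first by rewrite mem_iota.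
  rewrite nth_r // ptz asboolT //= ple_t // pleE // ptz.
  exact/asboolP.
Qed.

Lemma core_small : size e <= 8 ->
  [\/ size e <= 1, ~ path_connected R X |
      exists (n : nat) (x : X), 0 < n /\ ~ trivial_homotopy_group R n x].
Proof.
move=> e8; have me : size e = m by rewrite /m size_sort.
have : settled s.
  apply: (exploreP explore_cores); rewrite ?take0 ?size_s -?me ?e8 //= => k km.
  by rewrite nth_mkseq -?me // size_mkseq; split=> //; apply: extends_row; rewrite -me.
rewrite /settled size_s -me; case: ifP => [e1 _|_]; first by constructor 1.
case: ifP => [up _|_ /non_trivialP[[A dis]|[n [col [k [x [l sph]]]]]]].
(* This outcome is impossible, because the whole core has no up beat point. *)
- case/hasP: up => i; rewrite mem_iota size_s => /andP[_ im] /hasP[j].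
  rewrite mem_iota => /andP[_ jm] /and3P[ji ij /allP beat].
  have nij : pt i != pt j by apply: contraNneq ji => /(pt_inj im jm) ->.
  have ile : spec_le (pt i) (pt j) by move: ij; rewrite pleE // => /asboolP.
  have [z [ze zi ilz nz]] := upe (pt_e im) (pt_e jm) nij ile.
  have zm : index z es < m by rewrite index_mem mem_es.
  have ptz : pt (index z es) = z by rewrite /pt nth_index // mem_es.
  have zi' : index z es != i by apply: contraNneq zi => <-; rewrite ptz.
  have iz : ple s i (index z es) by rewrite pleE // ptz; exact/asboolP.
  have := beat (index z es); rewrite mem_iota zi' iz => /(_ zm).
  by rewrite pleE // ptz => /asboolP.
- constructor 2; exact: (disconnected_path_connected ptsP lab_lt lab_mono ptK dis).
- constructor 3; exists n, (pt x); split; first by case/and5P: sph.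
  exact: (spherical_homotopy_group ptsP lab_lt lab_mono pt_mono ptK ple_leq sph).
Qed.

End Core.

Theorem theorem3p6 (R : realType) (X : topologicalType) :
  homotopically_trivial R X -> ~ contractible R X ->
  [set: 'I_9] #<= [set: X].
Proof.
move=> [[x0 _] pc triv] ncontr; apply: contrapT => /few_points[pts [ptsP pts8]].
have [e [r [rete downe upe]]] := exists_core R ptsP.
have e8 : size e <= 8.
  by apply: leq_trans pts8; apply: uniq_leq_size => [|x _]; [case: rete|exact: ptsP].
have [e1|//|[n [x [n0]]]] := core_small ptsP x0 rete downe upe e8; last first.
  by apply; exact: triv.
(* The core has a single point, since [r x0] belongs to it, and then [X] is contractible. *)
case: e rete e1 {downe upe e8} => [|a [|]] // rete _; last exact/ncontr/contractible_retract/rete.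
by case: rete => _ /(_ x0).
Qed.
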